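(* Let $n,p\ge 1$, $\lambda\ge 0$, and let $\Sigma$ be an $n$-dimensional complete (without boundary) $\lambda$-submanifold properly immersed in the Gauss space $\mathbb G^{n+p}$. Put $r_2=\frac{\lambda+\sqrt{\lambda^2+4n}}{2}$. If $\Sigma\subset E^{n+p}(r_2)$, then $\Sigma$ is compact and $\Sigma\subset S^{n+p-1}(r_2)$, and $\Sigma$ is a minimal submanifold of $S^{n+p-1}(r_2)$. Moreover, if $p=1$, then $\Sigma=S^n(r_2)$.
   Context: The Gauss space $\mathbb G^m$ is $\mathbb R^m$ with its Euclidean metric and the density $e^{-f}=(2\pi)^{-m/2}e^{-|X|^2/2}$, where $X$ is the position vector. For an $n$-dimensional submanifold $\Sigma$ of $\mathbb G^{n+p}$, $\mathbf H$ denotes the mean curvature vector (the trace of the second fundamental form, not divided by $n$), $X^\perp$ the component of $X$ normal to $\Sigma$, and $\mathbf H_f=\mathbf H+X^\perp$ the weighted mean curvature vector. $\Sigma$ is a $\lambda$-submanifold if $|\mathbf H_f|=\lambda$ on $\Sigma$ for a constant $\lambda\ge 0$. $E^{m}(r)=\{x\in\mathbb R^{m}:|x|\ge r\}$ is the complement of the open ball of radius $r$ centered at the origin, and $S^{m-1}(r)=\{x\in\mathbb R^m:|x|=r\}$ is the sphere of radius $r$ centered at the origin. *)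

(* Defs.v *)
From HB Require Import structures.
From mathcomp Require Import all_boot all_order all_algebra.
From mathcomp Require Import all_classical all_reals all_analysis.
Set Implicit Arguments.
Unset Strict Implicit.
Unset Printing Implicit Defensive.
Import Order.TTheory GRing.Theory Num.Theory.
Import numFieldNormedType.Exports.
Local Open Scope classical_set_scope.
Local Open Scope ring_scope.

(* The library norm `|x| on row vectors is the sup norm, so the Euclidean
   norm is defined separately (the two induce the same topology, and the same
   derivatives). *)
Definition dot (R : realType) (m : nat) (x y : 'rV[R]_m) : R :=
  \sum_(i < m) x 0 i * y 0 i.

Definition enorm (R : realType) (m : nat) (x : 'rV[R]_m) : R :=
  Num.sqrt (dot x x).

Definition esphere (R : realType) (m : nat) (r : R) : set 'rV[R]_m :=
  [set x | enorm x = r].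

Definition eball_compl (R : realType) (m : nat) (r : R) : set 'rV[R]_m :=
  [set x | r <= enorm x].

Definition partial (R : realType) (n m : nat) (i : 'I_n)
    (F : 'rV[R]_n -> 'rV[R]_m) : 'rV[R]_n -> 'rV[R]_m :=
  fun u => 'D_(delta_mx 0 i) F u.

(* C^oo on U.  Only meant for open U: the values of F outside U are then
   irrelevant. *)
Definition smooth_on (R : realType) (n m : nat) (U : set 'rV[R]_n)
    (F : 'rV[R]_n -> 'rV[R]_m) : Prop :=
  forall (s : seq 'I_n) (u : 'rV[R]_n), U u ->
    {for u, continuous (foldr (@partial R n m) F s)} /\
    forall i : 'I_n, derivable (foldr (@partial R n m) F s) u (delta_mx 0 i).

(* A homeomorphism between an open set of M and an open set of R^n; both maps
   are total functions with irrelevant values outside these sets. *)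
Record chart (R : realType) (n : nat) (M : topologicalType) := Chart {
  chart_dom : set M;
  chart_img : set 'rV[R]_n;
  chart_map : M -> 'rV[R]_n;
  chart_inv : 'rV[R]_n -> M;
  chart_dom_open : open chart_dom;
  chart_img_open : open chart_img;
  chart_map_img : forall x, chart_dom x -> chart_img (chart_map x);
  chart_inv_dom : forall u, chart_img u -> chart_dom (chart_inv u);
  chart_mapK : forall x, chart_dom x -> chart_inv (chart_map x) = x;
  chart_invK : forall u, chart_img u -> chart_map (chart_inv u) = u;
  chart_map_cont : forall x, chart_dom x -> {for x, continuous chart_map};
  chart_inv_cont : forall u, chart_img u -> {for u, continuous chart_inv}
}.

(* Manifolds without boundary, not necessarily connected. *)
Record smooth_manifold (R : realType) (n : nat) := SmoothManifold {
  carrier :> topologicalType;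
  manifold_hausdorff : hausdorff_space carrier;
  manifold_second_countable : @second_countable carrier;
  atlas : set (chart R n carrier);
  atlas_cover : forall x : carrier, exists2 c, atlas c & chart_dom c x;
  atlas_compat : forall c d, atlas c -> atlas d ->
    smooth_on [set u | chart_img c u /\ chart_dom d (chart_inv c u)]
      (chart_map d \o chart_inv c)
}.

(* [jacobian F u] has the partial derivatives of F as its rows. *)
Definition immersion (R : realType) (n m : nat) (M : smooth_manifold R n)
    (X : M -> 'rV[R]_m) : Prop :=
  forall c : chart R n M, atlas c ->
    smooth_on (chart_img c) (X \o chart_inv c) /\
    forall u, chart_img c u -> row_free (jacobian (X \o chart_inv c) u).

Definition proper_map (R : realType) (n m : nat) (M : smooth_manifold R n)
    (X : M -> 'rV[R]_m) : Prop :=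
  forall K : set 'rV[R]_m, compact K -> compact (X @^-1` K).

(* Completeness of the induced Riemannian metric.  A curve is parametrized by
   [0, 1], as the restriction of a map on R.  Velocities may vanish, so
   a piecewise C^1 curve can be reparametrized to be C^1: the lengths
   considered are those of all piecewise C^1 curves. *)
Definition C1_curve (R : realType) (n : nat) (M : smooth_manifold R n)
    (g : R -> M) : Prop :=
  continuous g /\
  forall c : chart R n M, atlas c -> forall t : R, chart_dom c (g t) ->
    derivable (chart_map c \o g) t 1 /\
    {for t, continuous (derive1 (chart_map c \o g))}.

Definition curve_length (R : realType) (n m : nat) (M : smooth_manifold R n)
    (X : M -> 'rV[R]_m) (g : R -> M) : \bar R :=
  (\int[lebesgue_measure]_(t in `[0%R, 1%R]) (enorm (derive1 (X \o g) t))%:E)%E.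

(* +oo between distinct connected components *)
Definition induced_dist (R : realType) (n m : nat) (M : smooth_manifold R n)
    (X : M -> 'rV[R]_m) (x y : M) : \bar R :=
  ereal_inf [set l | exists g : R -> M,
    [/\ C1_curve g, g 0 = x, g 1 = y & l = curve_length X g]].

Definition complete_immersion (R : realType) (n m : nat)
    (M : smooth_manifold R n) (X : M -> 'rV[R]_m) : Prop :=
  forall s : nat -> M,
    (forall e : R, 0 < e -> exists N : nat, forall i j : nat,
       (N <= i)%N -> (N <= j)%N -> (induced_dist X (s i) (s j) < e%:E)%E) ->
    exists x : M, s @ \oo --> x.

(* g_ij = <d_i F, d_j F>, the induced metric in the coordinates u; below, the
   tangential part of v is g^{ij} <v, d_j F> d_i F, and the mean curvature is
   the trace g^{ij} II_ij, not divided by n. *)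
Definition metric (R : realType) (n m : nat) (F : 'rV[R]_n -> 'rV[R]_m)
    (u : 'rV[R]_n) : 'M[R]_n :=
  \matrix_(i, j) dot (partial i F u) (partial j F u).

Definition tangent_part (R : realType) (n m : nat) (F : 'rV[R]_n -> 'rV[R]_m)
    (u : 'rV[R]_n) (v : 'rV[R]_m) : 'rV[R]_m :=
  \sum_(i < n) \sum_(j < n)
    (invmx (metric F u) i j * dot v (partial j F u)) *: partial i F u.

Definition normal_part (R : realType) (n m : nat) (F : 'rV[R]_n -> 'rV[R]_m)
    (u : 'rV[R]_n) (v : 'rV[R]_m) : 'rV[R]_m :=
  v - tangent_part F u v.

Definition second_ff (R : realType) (n m : nat) (F : 'rV[R]_n -> 'rV[R]_m)
    (u : 'rV[R]_n) (i j : 'I_n) : 'rV[R]_m :=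
  normal_part F u (partial i (partial j F) u).

Definition mean_curvature (R : realType) (n m : nat)
    (F : 'rV[R]_n -> 'rV[R]_m) (u : 'rV[R]_n) : 'rV[R]_m :=
  \sum_(i < n) \sum_(j < n) invmx (metric F u) i j *: second_ff F u i j.

(* For the Gaussian density e^{-f}, the gradient of f at x is x. *)
Definition weighted_mean_curvature (R : realType) (n m : nat)
    (F : 'rV[R]_n -> 'rV[R]_m) (u : 'rV[R]_n) : 'rV[R]_m :=
  mean_curvature F u + normal_part F u (F u).

Definition lambda_submanifold (R : realType) (n m : nat)
    (M : smooth_manifold R n) (X : M -> 'rV[R]_m) (lambda : R) : Prop :=
  forall c : chart R n M, atlas c -> forall u, chart_img c u ->
    enorm (weighted_mean_curvature (X \o chart_inv c) u) = lambda.

(* Orthogonal projection of R^m onto the tangent space at x of the sphere of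
   radius r > 0; the Levi-Civita connection of the sphere is the Euclidean
   derivative followed by this projection. *)
Definition sphere_tangent_part (R : realType) (m : nat) (r : R)
    (x v : 'rV[R]_m) : 'rV[R]_m :=
  v - (dot v x / r ^+ 2) *: x.

Definition sphere_second_ff (R : realType) (n m : nat) (r : R)
    (F : 'rV[R]_n -> 'rV[R]_m) (u : 'rV[R]_n) (i j : 'I_n) : 'rV[R]_m :=
  normal_part F u
    (sphere_tangent_part r (F u) (partial i (partial j F) u)).

Definition sphere_mean_curvature (R : realType) (n m : nat) (r : R)
    (F : 'rV[R]_n -> 'rV[R]_m) (u : 'rV[R]_n) : 'rV[R]_m :=
  \sum_(i < n) \sum_(j < n)
    invmx (metric F u) i j *: sphere_second_ff r F u i j.

Definition minimal_in_sphere (R : realType) (n m : nat)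
    (M : smooth_manifold R n) (X : M -> 'rV[R]_m) (r : R) : Prop :=
  range X `<=` esphere r /\
  forall c : chart R n M, atlas c -> forall u, chart_img c u ->
    sphere_mean_curvature r (X \o chart_inv c) u = 0.

(* Main.v *)
Require Import Defs.
From HB Require Import structures.
From mathcomp Require Import all_boot all_order all_algebra.
From mathcomp Require Import all_classical all_reals all_analysis.
From mathcomp Require Import perm ring lra.
Import Order.TTheory GRing.Theory Num.Theory.
Import numFieldNormedType.Exports.
Local Open Scope classical_set_scope.
Local Open Scope ring_scope.

(** In a chart, w = |F|^2/2 satisfies
      g^{ij} w_ij - b^l w_l = n + <H_f, F> - |F|^2,
    where b is a suitable drift; the right-hand side is at most
    n + lambda |F| - |F|^2, hence nonpositive where |F| >= r2.  By Hopf's strong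
    maximum principle the set {|X| = r2} is open, and it is closed.  On its
    complement, which is also clopen, |X| would reach a minimum (X is proper);
    there the left-hand side is nonnegative, so |X| <= r2, a contradiction.
    Hence |X| = r2 everywhere, and equality in Cauchy-Schwarz gives
    H_f = (lambda / r2) X, i.e. minimality in the sphere.

    Hopf's barrier is the Gaussian exp(- alpha |u - z|^2), compared with w on a
    small ball around a point where a ball lying in {w > min w} touches
    {w = min w}.  The second-derivative test at the minimum of the difference
    uses the factorization g^{-1} = C C^T with C = g^{-1} J, J the Jacobian.

    For p = 1, X is onto the sphere: at a point x1 where <X, q> is largest, a
    missed point q would be normal to the image, hence q = - X x1, and then X
    would be constant. *)

Set Implicit Arguments.
Unset Strict Implicit.
Unset Printing Implicit Defensive.

(** * Directional derivatives and the second-derivative test *)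

Section DirectionalDerivatives.
Context {R : realType} {V : normedModType R}.
Implicit Types (f g : V -> R) (u v x y : V).

Lemma is_derive_along (f : V -> R) u x (t l : R) :
  is_derive (u + t *: x) x f l -> is_derive t 1 (fun s => f (u + s *: x)) l.
Proof.
move=> [df fl].
have E : (fun h : R => h^-1 *: (((fun s => f (u + s *: x)) \o shift t) (h *: 1) -
                                f (u + t *: x))) =
    (fun h => h^-1 *: ((f \o shift (u + t *: x)) (h *: x) - f (u + t *: x))).
  by apply/funext => h /=; rewrite [_%:A]mulr1 scalerDl addrCA.
split; first by rewrite /derivable E; exact: df.
by rewrite -fl /derive E.
Qed.

Lemma is_derive_along0 (f : V -> R) u x (l : R) :
  is_derive (0 : R) 1 (fun s => f (u + s *: x)) l -> is_derive u x f l.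
Proof.
move=> [df fl].
have E : (fun h : R => h^-1 *: ((f \o shift u) (h *: x) - f u)) =
    (fun h : R => h^-1 *: (((fun s => f (u + s *: x)) \o shift 0) (h *: 1) -
                           f (u + 0 *: x))).
  by apply/funext => h /=; rewrite [_%:A]mulr1 addr0 scale0r addr0 [u + _]addrC.

split; first by rewrite /derivable E; exact: df.
by rewrite -fl /derive E.
Qed.

Lemma is_derive_dirZ f u x (c l : R) :
  is_derive u x f l -> is_derive u (c *: x) f (c * l).
Proof.
move=> fl; apply: is_derive_along0.
have -> : (fun s => f (u + s *: (c *: x))) = (fun s => f (u + s *: x)) \o (fun s => c * s).
  by apply/funext => s /=; rewrite scalerA mulrC.
rewrite mulrC; apply: (@is_derive1_comp _ (fun s => f (u + s *: x)) ( *%R c)).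
  by rewrite mulr0; apply: is_derive_along; rewrite scale0r addr0.
by have := is_deriveZ c (is_derive_id (0 : R) 1); rewrite [_ *: 1]mulr1.
Qed.

Lemma mean_value_along f (g : V -> R) u x :
  (forall s : R, 0 <= s <= 1 -> is_derive (u + s *: x) x f (g (u + s *: x))) ->
  exists2 s : R, 0 < s < 1 & f (u + x) - f u = g (u + s *: x).
Proof.
move=> fg; have fg' (s : R) : 0 <= s <= 1 ->
    is_derive s 1 (fun s => f (u + s *: x)) (g (u + s *: x)).
  by move=> /fg; exact: is_derive_along.
have [| |s s01] := @MVT _ (fun s => f (u + s *: x)) (fun s => g (u + s *: x)) 0 1 ltr01.
- by move=> s; rewrite in_itv /= => /andP[s0 s1]; apply: fg'; rewrite !ltW.
- apply: derivable_within_continuous => s; rewrite in_itv /= => s01.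
  by have [] := fg' _ s01.
- rewrite scale1r scale0r addr0 subr0 mulr1 => E.
  by exists s => //; move: s01; rewrite in_itv.
Qed.

(** The increment along [h *: (x + y)] is split at [u + h *: y]. The mean value theorem and the
    continuity of [g] handle the [x] leg; the [y] leg uses only the derivative at [u] itself. *)
Lemma is_derive_dirD f (g : V -> R) u x y (l : R) :
  (\forall v \near u, is_derive v x f (g v)) -> {for u, continuous g} ->
  is_derive u y f l -> is_derive u (x + y) f (g u + l).
Proof.
move=> fg cg [dy yl].
have cvx : (fun h : R => h^-1 *: (f (u + h *: y + h *: x) - f (u + h *: y))) @ 0^' --> g u.
  apply/cvgrPdist_lt => e e0.
  have /cvgrPdist_lt/(_ _ e0) ge := cg.
  have /nbhs_normP[d /= d0 dP] : \forall v \near u,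
      is_derive v x f (g v) /\ `|g u - g v| < e by exact: filterI.
  have k0 : 0 < `|x| + `|y| + 1 by rewrite ltr_wpDl// addr_ge0.
  near=> h.
  have hn0 : h != 0 by near: h; exact: nbhs_dnbhs_neq.
  have hd : `|h| < d / (`|x| + `|y| + 1).
    by near: h; apply: dnbhs0_lt; rewrite divr_gt0.
  have near_u s : 0 <= s <= 1 -> `|u - (u + h *: y + s *: (h *: x))| < d.
    move=> /andP[s0 s1]; rewrite -addrA opprD addrA subrr sub0r normrN.
    rewrite (le_lt_trans (ler_normD _ _))// !normrZ.
    rewrite ltr_pdivlMr// in hd; rewrite (le_lt_trans _ hd)//.
    rewrite (ger0_norm s0) mulrCA -mulrDr ler_wpM2l//.
    have : s * `|x| <= `|x| by rewrite ler_piMl.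
    lra.
  have [s s01 ->] := @mean_value_along f (fun v => h * g v) (u + h *: y) (h *: x)
    (fun s s01 => is_derive_dirZ h (dP _ (near_u s s01)).1).
  rewrite [_ *: _]mulKf//; apply: (dP _ (near_u s _)).2.
  by case/andP: s01 => s0 s1; rewrite !ltW.
have cvy : (fun h : R => h^-1 *: (f (u + h *: y) - f u)) @ 0^' --> l.
  rewrite -yl; have -> : (fun h : R => h^-1 *: (f (u + h *: y) - f u)) =
    (fun h => h^-1 *: ((f \o shift u) (h *: y) - f u)).
    by apply/funext => h /=; rewrite [u + _]addrC.
  exact: dy.
have E : (fun h : R => h^-1 *: ((f \o shift u) (h *: (x + y)) - f u)) =
    (fun h : R => h^-1 *: (f (u + h *: y + h *: x) - f (u + h *: y)) +
       h^-1 *: (f (u + h *: y) - f u)).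
  apply/funext => h /=; rewrite -scalerDr; congr (_ *: _).
  have -> : u + h *: y + h *: x = h *: (x + y) + u.
    by rewrite scalerDr addrC [u + _]addrC addrA.
  by ring.
have cv : (fun h : R => h^-1 *: ((f \o shift u) (h *: (x + y)) - f u)) @ 0^' --> g u + l.
  by rewrite E; apply: cvgD.
by split; [rewrite /derivable; apply/cvg_ex; exists (g u + l) | apply: (cvg_lim _ cv)].
Unshelve. all: by end_near. Qed.

End DirectionalDerivatives.

Section Partials.
Context {R : realType} {n : nat}.
Implicit Types (f : 'rV[R]_n -> R) (u x : 'rV[R]_n).
Local Notation e i := (delta_mx 0 i : 'rV[R]_n).

(** Coordinates of the direction are added one at a time by [is_derive_dirD], so linearity in the
    direction is obtained without passing through a Fréchet differential. *)
Lemma is_derive_of_partials f (g : 'I_n -> 'rV[R]_n -> R) u x :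
  (forall i, \forall v \near u, is_derive v (e i) f (g i v)) ->
  (forall i, {for u, continuous (g i)}) ->
  is_derive u x f (\sum_i x 0 i * g i u).
Proof.
move=> fg cg; rewrite {1}[x]row_sum_delta.
elim: (index_enum _) => [|i s IH].
  by rewrite !big_nil; exact: is_derive0.
rewrite !big_cons.
apply: (@is_derive_dirD _ _ f (fun v => x 0 i * g i v)) IH.
  by apply: filterS (fg i) => v; exact: is_derive_dirZ.
by exact: cvgMl_tmp (cg i).
Qed.

(** The derivatives are explicit data, so that the barrier and the squared norm can supply closed
    formulas. In [g2 i j] the outer derivative is the one along [e i]. *)
Definition C2_on (U : set 'rV[R]_n) f (g1 : 'I_n -> 'rV[R]_n -> R)
    (g2 : 'I_n -> 'I_n -> 'rV[R]_n -> R) : Prop :=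
  forall u, U u ->
    [/\ {for u, continuous f},
        forall i, is_derive u (e i) f (g1 i u) /\ {for u, continuous (g1 i)} &
        forall i j, is_derive u (e i) (g1 j) (g2 i j u) /\
                    {for u, continuous (g2 i j)}].

(** First-order part: Fermat's rule on lines. Second-order part: if the Hessian form were negative
    at [x], the derivative along [x], zero at [u], would be negative just after [u], and [f] would
    decrease there by the mean value theorem. *)
Lemma second_derivative_test (U : set 'rV[R]_n) f g1 g2 u :
  open U -> U u -> C2_on U f g1 g2 -> (\forall v \near u, f u <= f v) ->
  (forall i, g1 i u = 0) /\
  forall x : 'rV[R]_n, 0 <= \sum_i \sum_j x 0 i * x 0 j * g2 i j u.
Proof.
move=> oU Uu fC2 fmin.
have nU v : U v -> \near v, U v by move=> Uv; exact: open_nbhs_nbhs.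
pose g x v := \sum_j x 0 j * g1 j v.
have fgU x v : U v -> is_derive v x f (g x v).
  move=> Uv; apply: is_derive_of_partials => i.
    by apply: filterS (nU _ Uv) => w /fC2[_ /(_ i)[]].
  by have [_ /(_ i)[]] := fC2 _ Uv.
have fgmin x : \forall v \near u, is_derive v x f (g x v) /\ f u <= f v.
  by apply: filterI => //; apply: filterS (nU _ Uu) => v; exact: fgU.
have g0 x : g x u = 0.
  have /nbhs_normP[d /= d0 dP] := fgmin x.
  have k0 : 0 < `|x| + 1 by rewrite ltr_wpDl.
  pose r := d / (`|x| + 1); have r0 : 0 < r by rewrite divr_gt0.
  have near_u (t : R) : t \in `]- r, r[%R -> `|u - (u + t *: x)| < d.
    rewrite in_itv /= -ltr_norml => tr.
    rewrite opprD addrA subrr sub0r normrN normrZ.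
    rewrite ltr_pdivlMr// in tr; rewrite (le_lt_trans _ tr)// ler_wpM2l//; lra.
  have g0 : is_derive (0 : R) 1 (fun t => f (u + t *: x)) 0.
    apply: (@derive1_at_min _ _ (- r) r); first lra.
    - move=> t /near_u /dP[fx _]; have [] // := is_derive_along fx.
    - by rewrite in_itv /= r0 oppr_lt0 r0.
    - by move=> t /near_u /dP[_]; rewrite scale0r addr0.
  have g0' : is_derive (0 : R) 1 (fun t => f (u + t *: x)) (g x u).
    apply: is_derive_along; rewrite scale0r addr0.
    exact: fgU.
  by rewrite -(@derive_val _ _ _ _ _ _ _ g0') (@derive_val _ _ _ _ _ _ _ g0).
split=> [i|x].
  have := g0 (e i); rewrite /g (bigD1 i)//= big1 => [|j ji].
    by rewrite addr0 mxE !eqxx mul1r.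
  by rewrite mxE (negbTE ji) mul0r.
pose c := \sum_i \sum_j x 0 i * x 0 j * g2 i j u.
have gx : is_derive u x (g x) c.
  have -> : g x = \sum_j (fun v => x 0 j * g1 j v).
    by apply/funext => v; rewrite /g fct_sumE.
  rewrite /c exchange_big /=.
  apply: (@is_derive_sum _ _ _ n (fun j v => x 0 j * g1 j v)) => j.
  under eq_bigr do rewrite -mulrA mulrCA; rewrite -mulr_sumr.
  apply: (@is_deriveZ _ _ _ (g1 j) (x 0 j) u x).
  apply: (is_derive_of_partials (g := fun i => g2 i j)) => i.
    by apply: filterS (nU _ Uu) => w /fC2[_ _ /(_ i j)[]].
  by have [_ _ /(_ i j)[]] := fC2 _ Uu.
rewrite leNgt; apply/negP => c0.
have cvg_gx : (fun h : R => h^-1 * g x (u + h *: x)) @ 0^' --> c.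
  case: gx => dg <-; rewrite (_ : (fun h => _) =
      fun h => h^-1 *: ((g x \o shift u) (h *: x) - g x u)); first exact: dg.
  by apply/funext => h /=; rewrite g0 subr0 [u + _]addrC.
have gx_lt0 : \forall h \near 0^', h^-1 * g x (u + h *: x) < 0.
  exact: (cvgr_lt c).
have /nbhs_normP[d /= d0 dP] := fgmin x.
have [r /= r0 rP] := gx_lt0.
have k0 : 0 < `|x| + 1 by rewrite ltr_wpDl.
(* The first bound keeps the mean value parameter [s * h] where the difference quotient of [g x] is
   negative; the second keeps the segment where [u] is minimal. *)
pose h := Num.min (r / 2) (d / (`|x| + 1) / 2).
have h0 : 0 < h by rewrite lt_min !divr_gt0.
have hr : h < r.
  have : h <= r / 2 by rewrite ge_min lexx.
  lra.
have hd : h < d / (`|x| + 1).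
  have : h <= d / (`|x| + 1) / 2 by rewrite ge_min lexx orbT.
  have := divr_gt0 d0 k0; lra.
have near_u s : 0 <= s <= 1 -> `|u - (u + s *: (h *: x))| < d.
  move=> /andP[s0 s1].
  rewrite opprD addrA subrr sub0r normrN !normrZ.
  rewrite ltr_pdivlMr// in hd; rewrite (le_lt_trans _ hd)//.
  rewrite (ger0_norm s0) (gtr0_norm h0) mulrCA ler_wpM2l ?ltW//.
  have : s * `|x| <= `|x| by rewrite ler_piMl.
  lra.
have [s /andP[s0 s1] E] := @mean_value_along _ _ f (fun v => h * g x v) u (h *: x)
  (fun s s01 => is_derive_dirZ h (dP _ (near_u s s01)).1).
have : 0 <= h * g x (u + s *: (h *: x)).
  by rewrite -E subr_ge0; have [] := dP _ (near_u 1 _);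
    rewrite ?scale1r ?ler01 ?lexx.
rewrite pmulr_rge0//; apply/negP; rewrite -ltNge.
have : (s * h)^-1 * g x (u + (s * h) *: x) < 0.
  apply: rP => /=; last by rewrite mulf_neq0 ?gt_eqF.
  rewrite sub0r normrN gtr0_norm ?mulr_gt0//.
  by rewrite (lt_trans _ hr)// gtr_pMl.
by rewrite pmulr_rlt0 ?invr_gt0 ?mulr_gt0// scalerA.
Unshelve. all: by end_near. Qed.

End Partials.

(** * Hopf's strong maximum principle *)

Section Continuity.
Context {R : realType} {T : topologicalType}.

Lemma continuous_at_sum (I : Type) (r : seq I) (P : pred I) (F : I -> T -> R) (x : T) :
  (forall i, {for x, continuous (F i)}) ->
  {for x, continuous (fun y => \sum_(i <- r | P i) F i y)}.
Proof. by move=> cF; apply: cvg_big => [|i _]; [exact: add_continuous|exact: cF]. Qed.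

Lemma continuous_at_prod (I : Type) (r : seq I) (P : pred I) (F : I -> T -> R) (x : T) :
  (forall i, {for x, continuous (F i)}) ->
  {for x, continuous (fun y => \prod_(i <- r | P i) F i y)}.
Proof. by move=> cF; apply: cvg_big => [|i _]; [exact: mul_continuous|exact: cF]. Qed.

End Continuity.

(** * The Euclidean inner product *)

Section DotProduct.
Context {R : realType} {m : nat}.
Implicit Types (x y z : 'rV[R]_m) (c : R).

Lemma dotC x y : dot x y = dot y x.
Proof. by apply: eq_bigr => i _; rewrite mulrC. Qed.

Lemma dotDl x y z : dot (x + y) z = dot x z + dot y z.
Proof. by rewrite -big_split; apply: eq_bigr => i _; rewrite !mxE mulrDl. Qed.

Lemma dotZl c x y : dot (c *: x) y = c * dot x y.
Proof. by rewrite /dot mulr_sumr; apply: eq_bigr => i _; rewrite !mxE mulrA. Qed.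

Lemma dotNl x y : dot (- x) y = - dot x y.
Proof. by rewrite -scaleN1r dotZl mulN1r. Qed.

Lemma dotBl x y z : dot (x - y) z = dot x z - dot y z.
Proof. by rewrite dotDl dotNl. Qed.

Lemma dotDr x y z : dot x (y + z) = dot x y + dot x z.
Proof. by rewrite !(dotC x) dotDl. Qed.

Lemma dotZr c x y : dot x (c *: y) = c * dot x y.
Proof. by rewrite !(dotC x) dotZl. Qed.

Lemma dotBr x y z : dot x (y - z) = dot x y - dot x z.
Proof. by rewrite !(dotC x) dotBl. Qed.

Lemma dot_suml (I : Type) (r : seq I) (P : pred I) (F : I -> 'rV[R]_m) y :
  dot (\sum_(i <- r | P i) F i) y = \sum_(i <- r | P i) dot (F i) y.
Proof.
by rewrite exchange_big; apply: eq_bigr => k _; rewrite summxE mulr_suml.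
Qed.

Lemma dot_ge0 x : 0 <= dot x x.
Proof. by apply: sumr_ge0 => i _; rewrite -expr2 sqr_ge0. Qed.

Lemma dot_eq0 x : (dot x x == 0) = (x == 0).
Proof.
apply/idP/eqP => [|->]; last by rewrite /dot big1// => i _; rewrite mxE mul0r.
rewrite psumr_eq0 => [/allP x0|i _]; last by rewrite -expr2 sqr_ge0.
apply/rowP => i; rewrite mxE; have := x0 i; rewrite mem_index_enum => /(_ isT).
by rewrite mulf_eq0 orbb => /eqP.
Qed.

Lemma dot_gt0 x : (0 < dot x x) = (x != 0).
Proof. by rewrite lt_def dot_eq0 dot_ge0 andbT. Qed.

Lemma dot_mulmx x y : dot x y = (x *m y^T) 0 0.
Proof. by rewrite mxE; apply: eq_bigr => i _; rewrite mxE. Qed.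

Lemma dot_delta x i : dot x (delta_mx 0 i) = x 0 i.
Proof.
rewrite /dot (bigD1 i)//= big1 => [|j ji]; first by rewrite addr0 mxE !eqxx mulr1.
by rewrite mxE (negbTE ji) mulr0.
Qed.

End DotProduct.

Lemma continuous_at_dot (R : realType) (T : topologicalType) (m : nat)
    (F G : T -> 'rV[R]_m) (x : T) :
  {for x, continuous F} -> {for x, continuous G} ->
  {for x, continuous (fun y => dot (F y) (G y))}.
Proof.
move=> cF cG; apply: continuous_at_sum => i.
apply: cvgM.
  exact: (cvg_comp _ _ cF (@coord_continuous _ _ _ 0 i (F x))).
exact: (cvg_comp _ _ cG (@coord_continuous _ _ _ 0 i (G x))).
Qed.

(** * The Gaussian barrier and its derivatives *)

Section GaussianBarrier.
Context {R : realType} {n : nat}.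
Implicit Types (f g : 'rV[R]_n -> R) (u v x y z : 'rV[R]_n) (U : set 'rV[R]_n).
Local Notation e i := (delta_mx 0 i : 'rV[R]_n).

Lemma C2_onBZ U (c : R) f (f1 : 'I_n -> _) (f2 : 'I_n -> 'I_n -> _)
    g (g1 : 'I_n -> _) (g2 : 'I_n -> 'I_n -> _) :
  C2_on U f f1 f2 -> C2_on U g g1 g2 ->
  C2_on U (fun v => f v - c * g v) (fun i v => f1 i v - c * g1 i v)
    (fun i j v => f2 i j v - c * g2 i j v).
Proof.
have cB p q (u : 'rV[R]_n) : {for u, continuous p} -> {for u, continuous q} ->
    {for u, continuous (fun v => p v - c * q v)}.
  by move=> cp cq; exact: (cvgB cp (cvgMl_tmp cq)).
have dB p q (u x : 'rV[R]_n) dp dq : is_derive u x p dp -> is_derive u x q dq ->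
    is_derive u x (fun v => p v - c * q v) (dp - c * dq).
  by move=> pd qd; apply: (@is_deriveB _ _ _ p (fun v => c * q v)); exact: is_deriveZ.
move=> fC gC u Uu; have [cf cf1 cf2] := fC u Uu; have [cg cg1 cg2] := gC u Uu.
split=> [|i|i j]; first exact: cB.
  by split; [apply: dB; [exact: (cf1 i).1 | exact: (cg1 i).1]|
             apply: cB; [exact: (cf1 i).2 | exact: (cg1 i).2]].
by split; [apply: dB; [exact: (cf2 i j).1 | exact: (cg2 i j).1]|
           apply: cB; [exact: (cf2 i j).2 | exact: (cg2 i j).2]].
Qed.

Definition gaussian (alpha : R) z v := expR (- alpha * dot (v - z) (v - z)).

Lemma continuous_sub z : continuous (fun v => v - z).
Proof. by move=> u; exact: (cvgB cvg_id (cvg_cst _)). Qed.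

Lemma continuous_coord_sub z i : continuous (fun v => (v - z) 0 i).
Proof.
move=> u; apply: (@continuous_comp _ _ _ (fun v => v - z) (fun M : 'rV[R]_n => M 0 i)).
  exact: continuous_sub.
exact: coord_continuous.
Qed.

Lemma continuous_gaussian alpha z : continuous (gaussian alpha z).
Proof.
move=> u; apply: (@continuous_comp _ _ _ (fun v => - alpha * dot (v - z) (v - z)));
  last exact: continuous_expR.
exact: (cvgMl_tmp (continuous_at_dot (@continuous_sub z u) (@continuous_sub z u))).
Qed.

Lemma is_derive_coord_sub z i u x : is_derive u x (fun v => (v - z) 0 i) (x 0 i).
Proof.
apply: is_derive_along0.
rewrite (_ : (fun _ => _) = cst ((u - z) 0 i) + x 0 i \*: id); last first.
  by apply/funext => s; rewrite !fctE /= !mxE [_ *: _]mulrC; ring.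
have d := is_deriveD (is_derive_cst ((u - z) 0 i) (0 : R) (1 : R))
  (is_deriveZ (x 0 i) (is_derive_id (0 : R) (1 : R))).
by apply: (is_derive_eq d); rewrite add0r [_ *: _]mulr1.
Qed.

Lemma is_derive_gaussian alpha z u x :
  is_derive u x (gaussian alpha z) (- 2 * alpha * dot (u - z) x * gaussian alpha z u).
Proof.
apply: is_derive_along0.
pose A := dot (u - z) (u - z); pose B := 2 * dot (u - z) x.
(* The exponent restricted to the line through [u] is a quadratic polynomial in [s], here in Horner
   form. *)
pose p (s : R) := - alpha * (A + s * (B + s * dot x x)).
rewrite (_ : (fun _ => _) = expR \o p); last first.
  apply/funext => s; rewrite /gaussian /= /p; congr (expR (_ * _)); rewrite /A /B.
  have -> : u + s *: x - z = (u - z) + s *: x by rewrite addrAC.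
  by move: (u - z) => d; rewrite dotDl !dotDr !dotZl !dotZr (dotC x d); ring.
have pd : is_derive (0 : R) 1 p (- 2 * alpha * dot (u - z) x).
  have did := is_derive_id (0 : R) (1 : R).
  have d1 := is_deriveM did
    (is_deriveD (is_derive_cst B (0 : R) (1 : R)) (is_deriveZ (dot x x) did)).
  have d2 := is_deriveZ (- alpha) (is_deriveD (is_derive_cst A (0 : R) (1 : R)) d1).
  move: d2; rewrite (_ : - alpha \*: _ = p) => [d2|]; last first.
    by apply/funext => s; rewrite /p !fctE /GRing.scale /= /GRing.scale /=; ring.
  by apply: (is_derive_eq d2); rewrite !fctE /GRing.scale /= /B; ring.
rewrite mulrC (_ : gaussian _ _ _ = expR (p 0)); first exact: is_derive1_comp.
by rewrite /p /gaussian mul0r addr0.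
Qed.

Definition gaussian1 alpha z (i : 'I_n) v :=
  - 2 * alpha * (v - z) 0 i * gaussian alpha z v.

Definition gaussian2 alpha z (i j : 'I_n) v :=
  (4 * alpha ^+ 2 * (v - z) 0 i * (v - z) 0 j - 2 * alpha * (i == j)%:R) *
  gaussian alpha z v.

Lemma C2_on_gaussian U alpha z :
  C2_on U (gaussian alpha z) (gaussian1 alpha z) (gaussian2 alpha z).
Proof.
have c1 i : continuous (fun v => - 2 * alpha * (v - z) 0 i).
  by move=> u; exact: (cvgMl_tmp (@continuous_coord_sub z i u)).
move=> u _; split=> [|i|i j]; first exact: continuous_gaussian.
  split; last exact: (cvgM (c1 i u) (@continuous_gaussian alpha z u)).
  by rewrite /gaussian1 -dot_delta; exact: is_derive_gaussian.
split; last first.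
  apply: (cvgM _ (@continuous_gaussian alpha z u)); apply: (cvgB _ (cvg_cst _)).
  apply: (cvgM _ (@continuous_coord_sub z j u)).
  exact: (cvgMl_tmp (@continuous_coord_sub z i u)).
have dc : is_derive u (e i) (fun v => - 2 * alpha * (v - z) 0 j)
    (- 2 * alpha * (i == j)%:R).
  rewrite [(i == j)%:R](_ : _ = e i 0 j); last by rewrite mxE eqxx eq_sym.
  exact: (is_deriveZ _ (is_derive_coord_sub z j u (e i))).
apply: (is_derive_eq (is_deriveM dc (is_derive_gaussian alpha z u (e i)))).
rewrite dot_delta /gaussian2 /GRing.scale /=; ring.
Qed.

End GaussianBarrier.

(** * Elliptic operators and Hopf's contact argument *)

Section HopfLemma.
Context {R : realType} {n : nat}.
Implicit Types (u v x y z : 'rV[R]_n) (U : set 'rV[R]_n).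
Implicit Types (a : 'rV[R]_n -> 'M[R]_n) (b : 'rV[R]_n -> 'rV[R]_n).

Lemma gaussian_gt0 (alpha : R) z v : 0 < gaussian alpha z v.
Proof. exact: expR_gt0. Qed.

Definition elliptic_op (a : 'rV[R]_n -> 'M[R]_n) (b : 'rV[R]_n -> 'rV[R]_n)
    (f1 : 'I_n -> 'rV[R]_n -> R) (f2 : 'I_n -> 'I_n -> 'rV[R]_n -> R) v : R :=
  \sum_i \sum_j a v i j * f2 i j v - \sum_i b v 0 i * f1 i v.

Lemma elliptic_opBZ a b (c : R) f1 f2 g1 g2 v :
  elliptic_op a b (fun i v => f1 i v - c * g1 i v)
    (fun i j v => f2 i j v - c * g2 i j v) v =
  elliptic_op a b f1 f2 v - c * elliptic_op a b g1 g2 v.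
Proof.
rewrite /elliptic_op.
under eq_bigr do under eq_bigr do rewrite mulrBr mulrCA.
under eq_bigr do rewrite sumrB -mulr_sumr.
rewrite sumrB -mulr_sumr.
under [X in _ - X = _]eq_bigr do rewrite mulrBr mulrCA.
rewrite sumrB -mulr_sumr; ring.
Qed.

(** The contraction is the sum, over the columns of [C], of the form [h] evaluated at the column. *)
Lemma gram_contract_ge0 k (C : 'M[R]_(n, k)) (h : 'I_n -> 'I_n -> R) :
  (forall x : 'rV[R]_n, 0 <= \sum_i \sum_j x 0 i * x 0 j * h i j) ->
  0 <= \sum_i \sum_j (C *m C^T) i j * h i j.
Proof.
move=> h0.
have -> : \sum_i \sum_j (C *m C^T) i j * h i j =
    \sum_l \sum_i \sum_j (col l C)^T 0 i * (col l C)^T 0 j * h i j.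
  rewrite [RHS]exchange_big; apply: eq_bigr => i _ /=.
  rewrite [RHS]exchange_big; apply: eq_bigr => j _ /=.
  by rewrite mxE mulr_suml; apply: eq_bigr => l _; rewrite !mxE.
by apply: sumr_ge0 => l _; exact: h0.
Qed.

Lemma elliptic_op_min_ge0 U f f1 f2 a b u k (C : 'M[R]_(n, k)) :
  open U -> U u -> C2_on U f f1 f2 -> (\forall v \near u, f u <= f v) ->
  a u = C *m C^T -> 0 <= elliptic_op a b f1 f2 u.
Proof.
move=> oU Uu fC fmin aC; have [f10 f20] := second_derivative_test oU Uu fC fmin.
rewrite /elliptic_op [X in _ - X]big1 => [|i _]; last by rewrite f10 mulr0.
by rewrite subr0 aC gram_contract_ge0.
Qed.

(** At [y] the operator gives the Gaussian times [2 * alpha * (2 * alpha * A - B)]: for large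
    [alpha] the ellipticity in the direction [y - z] dominates the trace and the drift. *)
Lemma elliptic_op_gaussian_gt0 a b y z :
  0 < \sum_i \sum_j a y i j * ((y - z) 0 i * (y - z) 0 j) ->
  exists2 alpha : R, 0 < alpha &
    0 < elliptic_op a b (gaussian1 alpha z) (gaussian2 alpha z) y.
Proof.
set A := \sum_i _ => A0.
pose B := \sum_i a y i i - \sum_i b y 0 i * (y - z) 0 i.
(* Chosen so that [2 * alpha * A] is [|B| + 1], which exceeds [B]. *)
pose alpha := (`|B| + 1) / (2 * A); have alpha0 : 0 < alpha.
  by rewrite divr_gt0 ?mulr_gt0// ltr_wpDl.
exists alpha => //.
have -> : elliptic_op a b (gaussian1 alpha z) (gaussian2 alpha z) y =
    gaussian alpha z y * (2 * alpha) * (2 * alpha * A - B).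
  rewrite /elliptic_op.
  have -> : \sum_i \sum_j a y i j * gaussian2 alpha z i j y =
      gaussian alpha z y * (2 * alpha) * (2 * alpha * A - \sum_i a y i i).
    rewrite /A mulrBr !mulr_sumr -sumrB; apply: eq_bigr => i _.
    rewrite [X in _ - X](_ : _ = \sum_j gaussian alpha z y * (2 * alpha) *
      (a y i j * (i == j)%:R)); last first.
      rewrite (bigD1 i)//= eqxx mulr1 big1 ?addr0// => j ji.
      by rewrite eq_sym (negbTE ji) !mulr0.
    rewrite !mulr_sumr -sumrB; apply: eq_bigr => j _.
    rewrite /gaussian2; ring.
  have -> : \sum_i b y 0 i * gaussian1 alpha z i y =
      - (gaussian alpha z y * (2 * alpha) * \sum_i b y 0 i * (y - z) 0 i).
    rewrite mulr_sumr -sumrN; apply: eq_bigr => i _.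
    rewrite /gaussian1; ring.
  rewrite /B; ring.
apply: mulr_gt0; first by apply: mulr_gt0; [exact: gaussian_gt0|rewrite mulr_gt0].
rewrite subr_gt0 (le_lt_trans (ler_norm _))//.
have -> : 2 * alpha * A = `|B| + 1.
  rewrite /alpha; field; rewrite gt_eqF//.
by rewrite ltrDl.
Qed.

Lemma continuous_at_elliptic_op U f f1 f2 a b y :
  C2_on U f f1 f2 -> U y ->
  (forall i j, {for y, continuous (fun v => a v i j)}) ->
  (forall i, {for y, continuous (fun v => b v 0 i)}) ->
  {for y, continuous (elliptic_op a b f1 f2)}.
Proof.
move=> fC Uy ca cb; have [_ cf1 cf2] := fC y Uy.
have c2 : {for y, continuous (fun v => \sum_i \sum_j a v i j * f2 i j v)}.
  apply: continuous_at_sum => i; apply: continuous_at_sum => j.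
  exact: (cvgM (ca i j) (cf2 i j).2).
have c1 : {for y, continuous (fun v => \sum_i b v 0 i * f1 i v)}.
  by apply: continuous_at_sum => i; exact: (cvgM (cb i) (cf1 i).2).
exact: (cvgB c2 c1).
Qed.

Lemma continuous_at_compact_min (f : 'rV[R]_n -> R) (A : set 'rV[R]_n) :
  A !=set0 -> compact A -> (forall v, A v -> {for v, continuous f}) ->
  exists2 c, A c & forall v, A v -> f c <= f v.
Proof.
move=> A0 cA cf; have [|c] := EVT_min_rV A0 cA (f := f).
  by apply: continuous_in_subspaceT => v; rewrite inE; exact: cf.
rewrite inE => Ac cP; exists c => // v Av; by apply: cP; rewrite inE.
Qed.

Lemma continuous_dist2 z : continuous (fun v => dot (v - z) (v - z)).
Proof.
move=> u; exact: (continuous_at_dot (@continuous_sub _ _ z u) (@continuous_sub _ _ z u)).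
Qed.

Lemma continuous_dist y : continuous (fun v => `|v - y|).
Proof. by move=> v; exact: (cvg_norm (@continuous_sub _ _ y v)). Qed.

Lemma compact_closed_ball (y : 'rV[R]_n) (r : R) :
  compact [set v | `|v - y| <= r].
Proof.
apply: bounded_closed_compact.
  exists (`|y| + r); split; first exact: num_real.
  move=> M yM v /= vy; rewrite -(subrK y v) (le_trans (ler_normD _ _))//.
  by rewrite (le_trans _ (ltW yM))// addrC lerD2l.
apply: (@closed_comp _ _ (fun v => `|v - y|) [set t | t <= r]); last exact: closed_le.
by move=> v _; exact: continuous_dist.
Qed.

(** A small multiple of the barrier is subtracted from [w] near [y]. On a small sphere around [y],
    the difference exceeds its value at [y]: inside the ball centered at [z] because [w] does so by
    a uniform gap, outside because the barrier is smaller than at [y]. Hence it has an interior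
    minimum, where the operator is nonnegative, although it is negative on the difference. *)
Lemma hopf_contact U w w1 w2 a b y z :
  open U -> U y -> C2_on U w w1 w2 ->
  (forall v, U v -> exists k (C : 'M[R]_(n, k)), a v = C *m C^T) ->
  (forall i j, {for y, continuous (fun v => a v i j)}) ->
  (forall i, {for y, continuous (fun v => b v 0 i)}) ->
  0 < \sum_i \sum_j a y i j * ((y - z) 0 i * (y - z) 0 j) ->
  (forall v, U v -> elliptic_op a b w1 w2 v <= 0) ->
  (forall v, U v -> w y <= w v) ->
  (forall v, U v -> v != y -> dot (v - z) (v - z) <= dot (y - z) (y - z) -> w y < w v) ->
  False.
Proof.
move=> oU Uy wC aC ca cb ayz Lw wmin wcontact.
have [alpha alpha0 Lh] := elliptic_op_gaussian_gt0 b ayz.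
set h := gaussian alpha z.
have hC := @C2_on_gaussian R n U alpha z.
have /nbhs_normP[d /= d0 dP] : \forall v \near y, U v /\
    0 < elliptic_op a b (gaussian1 alpha z) (gaussian2 alpha z) v.
  apply: filterI; first exact: open_nbhs_nbhs.
  exact: (cvgr_gt _ (continuous_at_elliptic_op hC Uy ca cb)).
pose r := d / 2; have r0 : 0 < r by rewrite divr_gt0.
have rd : r < d by rewrite /r; lra.
have ballP v : `|v - y| <= r -> U v /\
    0 < elliptic_op a b (gaussian1 alpha z) (gaussian2 alpha z) v.
  by move=> vr; apply: dP; rewrite /= distrC (le_lt_trans vr).
have sphereU v : `|v - y| = r -> U v.
  by move=> vr; apply: (proj1 (ballP v _)); rewrite vr.
(* The spheres around [y] are those of the sup norm, while the contact ball centered at [z] is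
   Euclidean. *)
pose S := [set v | `|v - y| = r /\ dot (v - z) (v - z) <= dot (y - z) (y - z)].
have ny v : `|v - y| = r -> v != y.
  by move=> vr; apply: contraTneq r0 => vy; rewrite -vr vy subrr normr0 ltxx.
have cS : compact S.
  apply: (subclosed_compact _ (@compact_closed_ball y r)).
    apply: closedI.
      apply: (@closed_comp _ _ (fun v => `|v - y|) [set t | t = r]); last exact: closed_eq.
      by move=> v _; exact: continuous_dist.
    apply: (@closed_comp _ _ (fun v => dot (v - z) (v - z))
      [set t | t <= dot (y - z) (y - z)]); last exact: closed_le.
    by move=> v _; exact: continuous_dist2.
  by move=> v [/= -> _].
have [c c0 cP] : exists2 c, 0 < c & forall v, S v -> w y + c <= w v.
  have [S0|S0] := pselect (S !=set0); last first.
    by exists 1 => // v Sv; exfalso; apply: S0; exists v.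
  have [|p [pr pz] pmin] := continuous_at_compact_min (f := w) S0 cS.
    by move=> v [/sphereU Uv _]; have [] := wC v Uv.
  exists (w p - w y); last by move=> v Sv; rewrite addrC subrK; exact: pmin.
  rewrite subr_gt0; apply: wcontact => //; last exact: ny.
  exact: sphereU.
(* As [h] is at most 1, subtracting [eps * h] uses up at most half of the gap [c]. *)
pose eps := c / 2; have eps0 : 0 < eps by rewrite divr_gt0.
pose v0 v := w v - eps * h v.
have h1 v : h v <= 1.
  by rewrite -expR0 ler_expR mulNr oppr_le0 mulr_ge0 ?dot_ge0// ltW.
have v0S v : `|v - y| = r -> v0 y < v0 v.
  move=> vr; have Uv := sphereU v vr.
  have hy0 := gaussian_gt0 alpha z y; rewrite -/h in hy0.
  have := mulr_gt0 eps0 hy0; rewrite /v0.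
  have [vz|vz] := leP (dot (v - z) (v - z)) (dot (y - z) (y - z)).
    have wv : w y + c <= w v by apply: cP.
    have : eps * h v <= eps by rewrite ler_piMr// ltW.
    rewrite /eps in eps0 *; lra.
  have : eps * h v < eps * h y.
    by rewrite ltr_pM2l// ltr_expR !mulNr ltrN2 ltr_pM2l.
  have := wmin v Uv; lra.
have [|||p /= pr pmin] :=
  continuous_at_compact_min (f := v0) (A := [set v | `|v - y| <= r]).
- by exists y; rewrite /= subrr normr0 ltW.
- exact: compact_closed_ball.
- move=> v /= vr; have [Uv _] := ballP v vr.
  have := C2_onBZ eps wC hC; move=> /(_ v Uv)[]; exact.
have {}pr : `|p - y| < r.
  rewrite lt_neqAle pr andbT; apply/eqP => /v0S; rewrite ltNge.
  by rewrite pmin//= subrr normr0 ltW.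
have [Up Lhp] := ballP p (ltW pr).
have pmin' : \forall v \near p, v0 p <= v0 v.
  apply/nbhs_normP; exists (r - `|p - y|); first by rewrite /= subr_gt0.
  move=> v /= pv; apply: pmin => /=.
  rewrite -[v - y](subrKA p) (le_trans (ler_normD _ _))// distrC; lra.
have [k [C aE]] := aC p Up.
have := elliptic_op_min_ge0 b oU Up (C2_onBZ eps wC hC) pmin' aE.
rewrite elliptic_opBZ leNgt => /negP; apply.
by rewrite subr_lt0 (le_lt_trans (Lw p Up))// mulr_gt0.
Qed.

End HopfLemma.

(** * The strong minimum principle *)

Section StrongMinimum.
Context {R : realType} {n : nat}.
Implicit Types (u v x y z : 'rV[R]_n) (U : set 'rV[R]_n).
Implicit Types (a : 'rV[R]_n -> 'M[R]_n) (b : 'rV[R]_n -> 'rV[R]_n).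

Lemma norm_le_dot x (s : R) : 0 <= s -> dot x x <= s ^+ 2 -> `|x| <= s.
Proof.
move=> s0 xs; rewrite /Num.Def.normr/= mx_normrE (bigmax_le _ s0)//= => -[i j] _.
rewrite ord1 -(ger0_norm s0) -ler_sqr ?nnegrE// !real_normK ?num_real//.
rewrite (le_trans _ xs)// /dot (bigD1 j)//= expr2 lerDl.
by apply: sumr_ge0 => k _; rewrite -expr2 sqr_ge0.
Qed.

(* The ball of diameter [x, y] meets the boundary of the ball centered at x
   through y only at y. *)
Lemma dist2_midpoint v x y : v != y ->
  dot (v - 2^-1 *: (x + y)) (v - 2^-1 *: (x + y)) <=
    dot (y - 2^-1 *: (x + y)) (y - 2^-1 *: (x + y)) ->
  dot (v - x) (v - x) < dot (y - x) (y - x).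
Proof.
rewrite -subr_eq0 -dot_gt0.
have -> : y - 2^-1 *: (x + y) = 2^-1 *: (y - x).
  by apply/rowP => i; rewrite !mxE; field.
have -> : v - 2^-1 *: (x + y) = (v - y) + 2^-1 *: (y - x).
  by apply/rowP => i; rewrite !mxE; field.
have -> : v - x = (v - y) + (y - x) by rewrite subrKA.
move: (v - y) (y - x) => A B A0.
rewrite !dotDl !dotDr !dotZl !dotZr (dotC B A).
move: (dot A A) (dot A B) (dot B B) A0 => p q r; lra.
Qed.

(** Continuity of [w] is known only on [U], so the level set is shown closed through its adherent
    points, which lie in [K] and hence in [U]. *)
Lemma closed_level U (w : 'rV[R]_n -> R) (K : set 'rV[R]_n) (c : R) :
  closed K -> K `<=` U -> (forall v, U v -> {for v, continuous w}) ->
  closed [set v | K v /\ w v = c].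
Proof.
move=> cK KU cw v clv.
have Kv : K v.
  by apply: cK => B /clv [p [[Kp _] Bp]]; exists p.
split=> //; apply: contrapT => /eqP wvc.
have ne : \forall t \near w v, t != c.
  by apply: open_nbhs_nbhs; split; [exact: open_neq|].
have [p [[_ wpc]]] := clv _ (cw v (KU _ Kv) _ ne).
by rewrite /= wpc eqxx.
Qed.

(** If [w x] exceeded the minimum for some [x] near [u], let [y] be a point of the minimum set
    nearest to [x]. The ball centered at [x] through [y] has no minimum point in its interior, and
    [hopf_contact] applies at [y]. *)
Theorem strong_minimum_principle U w w1 w2 a b u :
  open U -> U u -> C2_on U w w1 w2 ->
  (forall v, U v -> exists k (C : 'M[R]_(n, k)), a v = C *m C^T) ->
  (forall v x, U v -> x != 0 -> 0 < \sum_i \sum_j a v i j * (x 0 i * x 0 j)) ->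
  (forall v i j, U v -> {for v, continuous (fun v => a v i j)}) ->
  (forall v i, U v -> {for v, continuous (fun v => b v 0 i)}) ->
  (forall v, U v -> elliptic_op a b w1 w2 v <= 0) ->
  (forall v, U v -> w u <= w v) ->
  \forall v \near u, w v = w u.
Proof.
move=> oU Uu wC aC apos ca cb Lw wmin.
have /nbhs_normP[d /= d0 dU] : \forall v \near u, U v by exact: open_nbhs_nbhs.
(* Both [u] and [y] are within [s] of [x], and any minimum point within [s] of [x] is within [2 * s]
   of [u], hence in [K], whose radius [4 * s] is below [d]. *)
pose s := d / 8; have s0 : 0 < s by rewrite divr_gt0.
have ds : d = 8 * s by rewrite /s; field.
have : \forall x \near u, dot (x - u) (x - u) < s ^+ 2.
  apply: (cvgr_lt _ (@continuous_dist2 _ _ u u)).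
  by rewrite subrr [ltLHS](_ : _ = 0) ?exprn_gt0//; apply/eqP; rewrite dot_eq0.
apply: filterS => x xs; apply: contrapT => /eqP wx.
have xu : `|x - u| <= s by apply: norm_le_dot; exact: ltW.
have Ux : U x by apply: dU; rewrite /= distrC; lra.
have {}wx : w u < w x by rewrite lt_neqAle eq_sym wx wmin.
pose K := [set v | `|v - u| <= 4 * s].
have KU : K `<=` U by rewrite /K => v /= vu; apply: dU; rewrite /= distrC; lra.
pose Z := [set v | K v /\ w v = w u].
have cZ : compact Z.
  apply: (subclosed_compact _ (@compact_closed_ball _ _ u (4 * s))); last by move=> v [].
  apply: (closed_level _ KU) => [|v /wC[]//].
  apply: (@closed_comp _ _ (fun v => `|v - u|) [set t | t <= 4 * s]); last exact: closed_le.
  by move=> v _; exact: continuous_dist.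
have Zu : Z u by split=> //; rewrite /K /= subrr normr0 mulr_ge0// ltW.
have [||y [Ky wy] ymin] :=
  continuous_at_compact_min (f := fun v => dot (v - x) (v - x)) _ cZ.
- by exists u.
- by move=> v _; exact: continuous_dist2.
have yx : dot (y - x) (y - x) < s ^+ 2.
  rewrite (le_lt_trans (ymin _ Zu))//.
  by rewrite -opprB dotNl dotC dotNl opprK.
have nyx : y != x by apply: contraTneq wx => <-; rewrite wy ltxx.
(* Centering at the midpoint makes [y] the only point of the closed ball that can be a minimum
   point. *)
apply: (hopf_contact (z := 2^-1 *: (x + y)) oU (KU _ Ky) wC aC _ _ _ Lw).
- by move=> i j; apply: ca; exact: KU.
- by move=> i; apply: cb; exact: KU.
- apply: apos; first exact: KU.
  have -> : y - 2^-1 *: (x + y) = 2^-1 *: (y - x).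
    by apply/rowP => i; rewrite !mxE; field.
  by rewrite scaler_eq0 negb_or subr_eq0 nyx invr_neq0.
- by move=> v Uv; rewrite wy; exact: wmin.
- move=> v Uv vy /(dist2_midpoint vy) vx.
  rewrite wy lt_neqAle wmin// andbT; apply: contraTneq vx => wv.
  rewrite -leNgt; have [vs|vs] := leP (dot (v - x) (v - x)) (s ^+ 2); last first.
    by rewrite ltW// (lt_trans yx).
  apply: ymin; split; last by rewrite wv.
  have vx : `|v - x| <= s by apply: norm_le_dot => //; exact: ltW.
  by rewrite /K /= -[v - u](subrKA x) (le_trans (ler_normD _ _))//; lra.
Qed.

End StrongMinimum.

(** * The squared norm in an immersed chart *)

Section MatrixContinuity.
Context {R : realType} {T : topologicalType}.

Lemma continuous_at_det n (A : T -> 'M[R]_n) (x : T) :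
  (forall i j, {for x, continuous (fun y => A y i j)}) ->
  {for x, continuous (fun y => \det (A y))}.
Proof.
move=> cA; apply: continuous_at_sum => s.
have c : {for x, continuous (fun y => \prod_i A y i (s i))}.
  by apply: continuous_at_prod => i; exact: cA.
exact: (cvgMl_tmp c).
Qed.

(** The cofactor formula is continuous where the determinant is nonzero, and it agrees with [invmx]
    near [x]; at singular matrices [invmx] has a default value. *)
Lemma continuous_at_invmx n (A : T -> 'M[R]_n) (x : T) :
  A x \in unitmx -> (forall i j, {for x, continuous (fun y => A y i j)}) ->
  forall i j, {for x, continuous (fun y => invmx (A y) i j)}.
Proof.
move=> Ax cA i j.
have dx0 : \det (A x) != 0 by rewrite unitmxE unitfE in Ax.
have cd := continuous_at_det cA.
pose f y := (\det (A y))^-1 * \adj (A y) i j.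
have fE y : \det (A y) != 0 -> f y = invmx (A y) i j.
  by move=> dy; rewrite /invmx unitmxE unitfE dy mxE.
have cf : {for x, continuous f}.
  have cc : {for x, continuous (fun y => cofactor (A y) j i)}.
    have c : {for x, continuous (fun y => \det (row' j (col' i (A y))))}.
      apply: continuous_at_det => k l.
      rewrite (_ : (fun y => _) = (fun y => A y (lift j k) (lift i l))); first exact: cA.
      by apply/funext => y; rewrite !mxE.
    exact: (cvgMl_tmp c).
  have -> : f = fun y => (\det (A y))^-1 * cofactor (A y) j i.
    by apply/funext => y; rewrite /f mxE.
  exact: (cvgM (cvgV dx0 cd) cc).
rewrite /prop_for /continuous_at -[X in _ --> X]fE//.
apply: cvg_trans cf; apply: near_eq_cvg.
have dn0 : \forall t \near \det (A x), t != 0.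
  by apply: open_nbhs_nbhs; split; [exact: open_neq|].
have dy0 : \forall y \near x, \det (A y) != 0 := cd _ dn0.
by apply: filterS dy0 => y; exact: fE.
Qed.

End MatrixContinuity.

Lemma is_derive_dot (R : realType) (V : normedModType R) (m : nat)
    (F G : V -> 'rV[R]_m) (u x : V) (dF dG : 'rV[R]_m) :
  is_derive u x F dF -> is_derive u x G dG ->
  is_derive u x (fun v => dot (F v) (G v)) (dot dF (G u) + dot (F u) dG).
Proof.
move=> [dvF vF] [dvG vG].
have coord (H : V -> 'rV[R]_m) dH k : derivable H u x -> 'D_x H u = dH ->
    is_derive u x (fun v => H v 0 k) (dH 0 k).
  move=> dvH <-; split; first by move/derivable_mxP : dvH.
  by rewrite derive_mx// mxE.
have -> : (fun v => dot (F v) (G v)) = \sum_k (fun v => F v 0 k * G v 0 k).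
  by apply/funext => v; rewrite fct_sumE.
rewrite /dot -big_split /=.
apply: (@is_derive_sum _ _ _ m (fun k v => F v 0 k * G v 0 k)) => k.
apply: (is_derive_eq (is_deriveM (coord F dF k dvF vF) (coord G dG k dvG vG))).
by rewrite addrC /GRing.scale /=; congr (_ + _); rewrite mulrC.
Qed.

Section ImmersedChart.
Context {R : realType} {n m : nat}.
Variables (U : set 'rV[R]_n) (F : 'rV[R]_n -> 'rV[R]_m).
Hypotheses (n0 : (0 < n)%N) (oU : open U) (sF : smooth_on U F)
  (jF : forall u, U u -> row_free (jacobian F u)).
Implicit Types (u v : 'rV[R]_n) (x y : 'rV[R]_m).
Local Notation e i := (delta_mx 0 i : 'rV[R]_n).
Local Notation D i := (partial i F).
Local Notation DD i j := (partial i (partial j F)).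
Local Notation ginv u := (invmx (metric F u)).

(* ['d] is a choice with default value 0, so full rank of the jacobian entails
   differentiability. *)
Lemma not_differentiable_diff u : ~ differentiable F u -> 'd F u = \0 :> (_ -> _).
Proof.
move=> nd; rewrite /diff getPN// => df dfP; apply: nd; apply/diffP.
exact: (@getPex _ (fun df0 : {linear 'rV[R]_n -> 'rV[R]_m} => continuous df0 /\ _)
  (ex_intro _ df dfP)).
Qed.

Definition tangent_frame u : 'M[R]_(n, m) := \matrix_i D i u.

Lemma row_free_tangent_frame u : U u -> row_free (tangent_frame u).
Proof.
move=> /jF; have [dF|/not_differentiable_diff dF] := pselect (differentiable F u).
  suff -> : jacobian F u = tangent_frame u by [].
  by apply/row_matrixP => i; rewrite rowK /partial deriveEjacobian// rowE.
have -> : jacobian F u = 0.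
  by apply/row_matrixP => i; rewrite rowE /jacobian mul_rV_lin1 dF row0.
by rewrite {1}/row_free mxrank0 => /eqP n_eq0; exfalso; move: n0; rewrite -n_eq0.
Qed.

Lemma metricE u : metric F u = tangent_frame u *m (tangent_frame u)^T.
Proof.
apply/matrixP => i j; rewrite !mxE; apply: eq_bigr => k _.
by rewrite !mxE.
Qed.

Lemma metric_sym u : (metric F u)^T = metric F u.
Proof. by rewrite metricE trmx_mul trmxK. Qed.

Lemma metric_unit u : U u -> metric F u \in unitmx.
Proof.
move=> Uu; rewrite -row_free_unit; apply/inj_row_free => v.
rewrite metricE => vg0; apply: (row_free_inj (row_free_tangent_frame Uu)).
apply/eqP; rewrite mul0mx -dot_eq0 dot_mulmx trmx_mul mulmxA -(mulmxA v) vg0.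
by rewrite mul0mx mxE.
Qed.

Lemma ginv_sym u i j : ginv u i j = ginv u j i.
Proof. by rewrite -{1}metric_sym -trmx_inv mxE. Qed.

Lemma ginv_gram u : U u ->
  ginv u = (ginv u *m tangent_frame u) *m (ginv u *m tangent_frame u)^T.
Proof.
move=> Uu; rewrite trmx_mul mulmxA -(mulmxA (ginv u)) -metricE.
rewrite mulVmx ?metric_unit// mul1mx.
by apply/matrixP => i j; rewrite mxE ginv_sym.
Qed.

(** By [ginv_gram] the form is the squared length of [x *m ginv u *m tangent_frame u]; both factors
    applied to [x] are injective. *)
Lemma ginv_pos u (x : 'rV[R]_n) : U u -> x != 0 ->
  0 < \sum_i \sum_j ginv u i j * (x 0 i * x 0 j).
Proof.
move=> Uu x0.
have -> : \sum_i \sum_j ginv u i j * (x 0 i * x 0 j) = (x *m ginv u *m x^T) 0 0.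
  rewrite mxE exchange_big; apply: eq_bigr => j _ /=.
  rewrite !mxE mulr_suml; apply: eq_bigr => i _; ring.
rewrite (ginv_gram Uu) mulmxA -mulmxA -trmx_mul -dot_mulmx dot_gt0.
apply: contra_neq x0; rewrite mulmxA => xC.
have xg : x *m ginv u = 0.
  by apply: (row_free_inj (row_free_tangent_frame Uu)); rewrite xC mul0mx.
by rewrite -(mulmxK (metric_unit Uu) x) -[x *m _ *m _]mulmxA mulmxV ?metric_unit//
  mulmx1 -(mulmxKV (metric_unit Uu) x) xg mul0mx.
Qed.

Lemma smooth_partial0 u : U u ->
  {for u, continuous F} /\ forall i, is_derive u (e i) F (D i u).
Proof.
move=> Uu; have [c d] := sF [::] Uu.
exact: (conj c (fun i => derivableP (d i))).
Qed.

Lemma smooth_partial1 u j : U u ->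
  {for u, continuous (D j)} /\ forall i, is_derive u (e i) (D j) (DD i j u).
Proof.
move=> Uu; have [c d] := sF [:: j] Uu.
exact: (conj c (fun i => derivableP (d i))).
Qed.

Lemma smooth_partial2 u i j : U u -> {for u, continuous (DD i j)}.
Proof. by move=> Uu; exact: (sF [:: i; j] Uu).1. Qed.

Definition half_norm2 u : R := dot (F u) (F u) / 2.
Definition half_norm2_1 (i : 'I_n) u : R := dot (D i u) (F u).
Definition half_norm2_2 (i j : 'I_n) u : R :=
  dot (DD i j u) (F u) + dot (D j u) (D i u).

Lemma C2_on_half_norm2 : C2_on U half_norm2 half_norm2_1 half_norm2_2.
Proof.
move=> u Uu; have [cF dF] := smooth_partial0 Uu; split=> [|i|i j].
- exact: (cvgMr_tmp (continuous_at_dot (F := F) (G := F) cF cF)).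
- have [cD _] := smooth_partial1 i Uu.
  split; last exact: (continuous_at_dot (F := D i) (G := F) cD cF).
  have -> : half_norm2 = 2^-1 \*: (fun u => dot (F u) (F u)).
    by apply/funext => v; rewrite /half_norm2 mulrC.
  apply: (is_derive_eq (is_deriveZ _ (is_derive_dot (dF i) (dF i)))).
  by rewrite (dotC (F u)) /GRing.scale /= /half_norm2_1; field.
- have [cDi _] := smooth_partial1 i Uu; have [cDj dDj] := smooth_partial1 j Uu.
  split; first exact: is_derive_dot.
  have cDD := @smooth_partial2 u i j Uu.
  have c1 := continuous_at_dot (F := DD i j) (G := F) cDD cF.
  have c2 := continuous_at_dot (F := D j) (G := D i) cDj cDi.
  exact: (cvgD c1 c2).
Qed.

Lemma continuous_at_ginv u i j : U u -> {for u, continuous (fun v => ginv v i j)}.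
Proof.
move=> Uu; apply: continuous_at_invmx; first exact: metric_unit.
move=> {i j} i j; rewrite (_ : (fun v => _) = (fun v => dot (D i v) (D j v))).
  exact: (continuous_at_dot (F := D i) (G := D j)
    (smooth_partial1 i Uu).1 (smooth_partial1 j Uu).1).
by apply/funext => v; rewrite mxE.
Qed.

(** Not the Laplace-Beltrami operator: the Christoffel terms are absent. Its normal part is the mean
    curvature vector. *)
Definition laplace_coord u : 'rV[R]_m := \sum_i \sum_j ginv u i j *: DD i j u.

(** The coordinates of the tangential part of [laplace_coord u + F u]. The first summand restores
    the Christoffel terms and the second is the gradient of the Gaussian weight, so [elliptic_op]
    becomes the drift Laplacian. *)
Definition drift u : 'rV[R]_n :=
  \row_j \sum_i ginv u i j * dot (laplace_coord u + F u) (D i u).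

Lemma dot_laplace_coord u y :
  dot (laplace_coord u) y = \sum_i \sum_j ginv u i j * dot (DD i j u) y.
Proof.
rewrite dot_suml; apply: eq_bigr => i _; rewrite dot_suml.
by apply: eq_bigr => j _; rewrite dotZl.
Qed.

Lemma continuous_at_drift u i : U u -> {for u, continuous (fun v => drift v 0 i)}.
Proof.
move=> Uu; rewrite (_ : (fun v => _) = fun v =>
    \sum_j ginv v j i * dot (laplace_coord v + F v) (D j v)); last first.
  by apply/funext => v; rewrite mxE.
have cD k := (smooth_partial1 k Uu).1.
apply: continuous_at_sum => j.
have c : {for u, continuous (fun v => dot (laplace_coord v + F v) (D j v))}.
  have -> : (fun v => dot (laplace_coord v + F v) (D j v)) =
     (fun v => \sum_p \sum_q ginv v p q * dot (DD p q v) (D j v) + dot (F v) (D j v)).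
    by apply/funext => v; rewrite dotDl dot_laplace_coord.
  have c : {for u, continuous
      (fun v => \sum_p \sum_q ginv v p q * dot (DD p q v) (D j v))}.
    apply: continuous_at_sum => p; apply: continuous_at_sum => q.
    exact: (cvgM (@continuous_at_ginv u p q Uu)
      (continuous_at_dot (F := DD p q) (G := D j) (@smooth_partial2 u p q Uu) (cD j))).
  exact: (cvgD c (continuous_at_dot (F := F) (G := D j) (smooth_partial0 Uu).1 (cD j))).
exact: (cvgM (@continuous_at_ginv u j i Uu) c).
Qed.

Lemma dot_tangent_part u x y :
  dot (tangent_part F u x) y =
  \sum_i \sum_j ginv u i j * dot x (D j u) * dot y (D i u).
Proof.
rewrite dot_suml; apply: eq_bigr => i _; rewrite dot_suml.
by apply: eq_bigr => j _; rewrite dotZl (dotC y).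
Qed.

Lemma tangent_part_sym u x y : dot (tangent_part F u x) y = dot x (tangent_part F u y).
Proof.
rewrite [RHS]dotC !dot_tangent_part exchange_big.
have := ginv_sym u; move: (ginv u) => g gs.
by apply: eq_bigr => i _; apply: eq_bigr => j _; rewrite gs; exact: mulrAC.
Qed.

Lemma normal_part_sym u x y : dot (normal_part F u x) y = dot x (normal_part F u y).
Proof. by rewrite /normal_part dotBl dotBr tangent_part_sym. Qed.

Lemma dot_mean_curvature u y :
  dot (mean_curvature F u) y = dot (laplace_coord u) (normal_part F u y).
Proof.
rewrite dot_laplace_coord dot_suml; apply: eq_bigr => i _; rewrite dot_suml.
by apply: eq_bigr => j _; rewrite dotZl normal_part_sym.
Qed.

Lemma ginv_trace u : U u -> \sum_i \sum_j ginv u i j * dot (D j u) (D i u) = n%:R.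
Proof.
move=> Uu; have := mxtrace1 R n; rewrite -(mulVmx (metric_unit Uu)) => <-.
apply: eq_bigr => i _; rewrite mxE; apply: eq_bigr => j _; congr (_ * _).
by rewrite mxE.
Qed.

(** With L for [laplace_coord] and T for the tangential part of F, the second-order terms give <L,
    F> + n and the drift gives <L + F, T>. Their difference regroups, since <L, F - T> = <H, F> and
    <F - T, F> = |F|^2 - <F, T>. *)
Lemma drift_laplace_half_norm2 u : U u ->
  elliptic_op (fun v => ginv v) drift half_norm2_1 half_norm2_2 u =
  n%:R + dot (weighted_mean_curvature F u) (F u) - dot (F u) (F u).
Proof.
move=> Uu; rewrite /elliptic_op /weighted_mean_curvature.
have -> : \sum_i \sum_j ginv u i j * half_norm2_2 i j u =
    dot (laplace_coord u) (F u) + n%:R.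
  rewrite -(ginv_trace Uu) dot_laplace_coord -big_split; apply: eq_bigr => i _.
  by rewrite -big_split; apply: eq_bigr => j _; rewrite mulrDr.
have -> : \sum_i drift u 0 i * half_norm2_1 i u =
    dot (laplace_coord u + F u) (tangent_part F u (F u)).
  rewrite [RHS]dotC dot_tangent_part exchange_big; apply: eq_bigr => j _.
  rewrite mxE mulr_suml; apply: eq_bigr => i _.
  rewrite /half_norm2_1 (dotC (D j u)).
  by move: (dot _ (D i u)) (dot _ (D j u)) (ginv u i j) => p q r; rewrite mulrAC.
rewrite [in RHS]dotDl dot_mean_curvature /normal_part dotBr dotBl.
have := tangent_part_sym u (F u) (F u).
move: (tangent_part F u (F u)) (laplace_coord u) (F u) => t y x ->; rewrite dotDl.
by move: (dot y x) (dot x x) (dot y t) (dot x t) => p q r s; ring.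
Qed.

End ImmersedChart.

(** * The Cauchy-Schwarz inequality and its equality case *)

Section EuclideanNorm.
Context {R : realType} {m : nat}.
Implicit Types (x y : 'rV[R]_m).

Lemma enorm_ge0 x : 0 <= enorm x.
Proof. exact: sqrtr_ge0. Qed.

Lemma enorm_sqr x : enorm x ^+ 2 = dot x x.
Proof. by rewrite sqr_sqrtr ?dot_ge0. Qed.

Lemma dot_le_enorm x y : dot x y <= enorm x * enorm y.
Proof.
have [p0 q0] := (enorm_ge0 x, enorm_ge0 y).
(* With p = |x| and q = |y|, this square expands to 2pq(pq - <x, y>); dividing by pq requires the
   zero cases apart. *)
have := dot_ge0 (enorm y *: x - enorm x *: y).
rewrite dotBl !dotBr !dotZl !dotZr (dotC y x) -!enorm_sqr.
move: p0 q0; rewrite !le0r => /predU1P[x0 _ _|p0].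
  suff -> : x = 0 by rewrite /dot big1 ?mulr_ge0 ?enorm_ge0// => i _; rewrite mxE mul0r.
  by apply/eqP; rewrite -dot_eq0 -enorm_sqr x0 expr0n.
move=> /predU1P[y0 _|q0].
  suff -> : y = 0.
    by rewrite dotC /dot big1 ?mulr_ge0 ?enorm_ge0// => i _; rewrite mxE mul0r.
  by apply/eqP; rewrite -dot_eq0 -enorm_sqr y0 expr0n.
move: (enorm x) (enorm y) (dot x y) p0 q0 => p q d p0 q0 H.
rewrite -subr_ge0 -(pmulr_rge0 _ (mulr_gt0 p0 q0)).
nra.
Qed.

Lemma enorm_eq_sqr x (r : R) : 0 < r -> (enorm x == r) = (dot x x == r ^+ 2).
Proof. by move=> r0; rewrite -enorm_sqr eqrXn2 ?enorm_ge0 ?ltW. Qed.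

(** The squared length of [x - (a / r) *: y] expands to a^2 - 2a^2 + a^2. *)
Lemma dot_enorm_parallel x y (a r : R) : r != 0 -> enorm x = a -> enorm y = r ->
  dot x y = a * r -> x = (a / r) *: y.
Proof.
move=> r0 xa yr xy; apply/eqP; rewrite -subr_eq0 -dot_eq0; apply/eqP.
rewrite dotBl !dotBr !dotZl !dotZr (dotC y x) -!enorm_sqr xa yr xy; field.
exact: r0.
Qed.

Lemma compact_dot_ball (c : R) : compact [set x : 'rV[R]_m | dot x x <= c].
Proof.
have cl : closed [set x : 'rV[R]_m | dot x x <= c].
  apply: (@closed_comp _ _ (fun x => dot x x) [set t | t <= c]); last exact: closed_le.
  move=> x _; exact: (continuous_at_dot (F := id) (G := id) cvg_id cvg_id).
apply: (subclosed_compact cl (@compact_closed_ball _ _ 0 (`|c| + 1))) => x /= xc.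
rewrite subr0; apply: norm_le_dot; first by rewrite addr_ge0.
have := ler_norm c; have := normr_ge0 c; move: `|c| => k; nra.
Qed.

End EuclideanNorm.

(** * The critical radius *)

Section CriticalRadius.
Context {R : realType}.
Variables (n : nat) (lambda : R).
Hypotheses (n0 : (0 < n)%N) (lambda0 : 0 <= lambda).
Definition critical_radius : R := (lambda + Num.sqrt (lambda ^+ 2 + 4 * n%:R)) / 2.
Local Notation r2 := critical_radius.

Lemma critical_radius_gt0 : 0 < r2.
Proof.
rewrite /r2 divr_gt0// ltr_wpDl// sqrtr_gt0.
by rewrite ltr_wpDl ?sqr_ge0// mulr_gt0 ?ltr0n.
Qed.

Lemma critical_radius_eq : r2 ^+ 2 = lambda * r2 + n%:R.
Proof.
have : Num.sqrt (lambda ^+ 2 + 4 * n%:R) ^+ 2 = lambda ^+ 2 + 4 * n%:R.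
  by rewrite sqr_sqrtr// addr_ge0 ?sqr_ge0// mulr_ge0.
rewrite /r2; move: (Num.sqrt _) => s; move: (n%:R : R) => k sE.
have -> : k = (s ^+ 2 - lambda ^+ 2) / 4 by rewrite sE; field.
by field.
Qed.

(** The quadratic factors as (r2 - r)(r + (r2 - lambda)), where r2 - lambda is positive because
    r2(r2 - lambda) = n. *)
Lemma critical_radius_leP (r : R) : 0 <= r ->
  (0 <= n%:R + lambda * r - r ^+ 2) = (r <= r2).
Proof.
move=> r0; have c0 := critical_radius_gt0; have cE := critical_radius_eq.
have k0 : 0 < n%:R :> R by rewrite ltr0n.
have cl : 0 < r2 - lambda.
  rewrite -(pmulr_rgt0 _ c0) mulrBr -expr2 cE mulrC; lra.
have -> : n%:R + lambda * r - r ^+ 2 = (r2 - r) * (r + (r2 - lambda)).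
  move: cE; rewrite expr2 => cE; have -> : n%:R = r2 * r2 - lambda * r2 by rewrite cE; ring.
  by ring.
by rewrite pmulr_lge0 ?subr_ge0// ltr_wpDl.
Qed.

End CriticalRadius.

(** * Local analysis of a lambda-submanifold in a chart *)

Section LambdaChart.
Context {R : realType} {n m : nat}.
Variables (U : set 'rV[R]_n) (F : 'rV[R]_n -> 'rV[R]_m) (lambda : R).
Hypotheses (n0 : (0 < n)%N) (lambda0 : 0 <= lambda) (oU : open U)
  (sF : smooth_on U F) (jF : forall u, U u -> row_free (jacobian F u))
  (lF : forall u, U u -> enorm (weighted_mean_curvature F u) = lambda).
Local Notation e i := (delta_mx 0 i : 'rV[R]_n).
Local Notation r2 := (critical_radius n lambda).
Local Notation ginv u := (invmx (metric F u)).

Lemma drift_laplace_le u : U u ->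
  elliptic_op (fun v => ginv v) (drift F) (half_norm2_1 F) (half_norm2_2 F) u <=
  n%:R + lambda * enorm (F u) - enorm (F u) ^+ 2.
Proof.
move=> Uu; rewrite (drift_laplace_half_norm2 n0 jF Uu) enorm_sqr lerB// lerD2l.
by rewrite -(lF Uu) dot_le_enorm.
Qed.

Lemma local_min_enorm_le u : U u ->
  (\forall v \near u, dot (F u) (F u) <= dot (F v) (F v)) -> enorm (F u) <= r2.
Proof.
move=> Uu Fmin; rewrite -critical_radius_leP ?enorm_ge0//.
apply: le_trans (drift_laplace_le Uu).
apply: (elliptic_op_min_ge0 (drift F) oU Uu (C2_on_half_norm2 sF) _ (ginv_gram n0 jF Uu)).
by apply: filterS Fmin => v; rewrite /half_norm2 ler_pM2r.
Qed.

Lemma enorm_critical_open u : U u -> (forall v, U v -> r2 <= enorm (F v)) ->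
  enorm (F u) = r2 -> \forall v \near u, dot (F v) (F v) = r2 ^+ 2.
Proof.
move=> Uu Fr2 ur2.
have r20 := critical_radius_gt0 n0 lambda0.
have : \forall v \near u, half_norm2 F v = half_norm2 F u.
  apply: (strong_minimum_principle oU Uu (C2_on_half_norm2 sF)
    (a := fun v => ginv v) (b := drift F)).
  - by move=> v Uv; eexists; eexists; exact: (ginv_gram n0 jF Uv).
  - by move=> v x; exact: ginv_pos.
  - by move=> v i j Uv; exact: (continuous_at_ginv n0 sF jF Uv).
  - by move=> v i Uv; exact: (continuous_at_drift n0 sF jF Uv).
  - move=> v Uv; apply: le_trans (drift_laplace_le Uv) _.
    (* A positive bound would give |F| <= r2, hence |F| = r2, where the bound vanishes. *)
    rewrite leNgt; apply/negP => pos; have := ltW pos.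
    rewrite critical_radius_leP ?enorm_ge0// => vr2; move: pos.
    have -> : enorm (F v) = r2 by apply/eqP; rewrite eq_le vr2 Fr2.
    by rewrite critical_radius_eq// [n%:R + _]addrC subrr ltxx.
  - move=> v Uv; rewrite /half_norm2 ler_pM2r// -!enorm_sqr ur2.
    by rewrite ler_sqr ?nnegrE ?enorm_ge0 ?Fr2// ltW.
apply: filterS => v; rewrite /half_norm2 -ur2 enorm_sqr => vu; lra.
Qed.

Hypothesis F_sphere : forall u, U u -> dot (F u) (F u) = r2 ^+ 2.

(** On the sphere [half_norm2] is constant, so every point is a minimum and the first-order
    condition applies. *)
Lemma dot_partial_sphere u i : U u -> dot (partial i F u) (F u) = 0.
Proof.
move=> Uu; have nU : \forall v \near u, U v by exact: open_nbhs_nbhs.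
have Fmin : \forall v \near u, half_norm2 F u <= half_norm2 F v.
  by apply: filterS nU => v Uv; rewrite /half_norm2 !F_sphere.
by have [/(_ i)] := second_derivative_test oU Uu (C2_on_half_norm2 sF) Fmin.
Qed.

Lemma tangent_part_sphere u : U u -> tangent_part F u (F u) = 0.
Proof.
move=> Uu; rewrite /tangent_part big1// => i _; rewrite big1// => j _.
by rewrite dotC dot_partial_sphere// mulr0 scale0r.
Qed.

Lemma half_norm2_2_sphere u i j : U u -> half_norm2_2 F i j u = 0.
Proof.
move=> Uu; have [_ _ /(_ i j)[d _]] := C2_on_half_norm2 sF Uu.
rewrite -(@derive_val _ _ _ _ _ _ _ d) -(derive_cst (0 : R) u (e i)).
apply: near_eq_derive; have : \forall v \near u, U v by exact: open_nbhs_nbhs.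
by apply: filterS => v Uv; rewrite /half_norm2_1 dot_partial_sphere.
Qed.

Lemma dot_laplace_coord_sphere u : U u -> dot (laplace_coord F u) (F u) = - n%:R.
Proof.
move=> Uu; apply/eqP; rewrite -addr_eq0 -(ginv_trace n0 jF Uu) dot_laplace_coord.
rewrite -big_split big1//= => i _; rewrite -big_split big1//= => j _.
by rewrite -mulrDr -[X in _ * X]/(half_norm2_2 F i j u) half_norm2_2_sphere// mulr0.
Qed.

(** The operator vanishes on the constant squared norm, so <H_f, F> = r2^2 - n = lambda r2 = |H_f|
    |F|: equality holds in Cauchy-Schwarz. *)
Lemma weighted_mean_curvature_sphere u : U u ->
  weighted_mean_curvature F u = (lambda / r2) *: F u.
Proof.
move=> Uu; have r20 := critical_radius_gt0 n0 lambda0.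
apply: dot_enorm_parallel; rewrite ?gt_eqF ?lF//.
  by apply/eqP; rewrite enorm_eq_sqr// F_sphere.
have := drift_laplace_half_norm2 n0 jF Uu.
rewrite F_sphere// critical_radius_eq// /elliptic_op.
rewrite big1 => [|i _]; last by rewrite big1// => j _; rewrite half_norm2_2_sphere ?mulr0.
rewrite big1 => [|i _]; last by rewrite /half_norm2_1 dot_partial_sphere ?mulr0.
by move: (dot _ _) => d dE; lra.
Qed.

(** F is normal to the immersion, so projecting to the sphere only adds (n / r2^2) F to H = (lambda
    / r2 - 1) F; the coefficients cancel by the equation of r2. *)
Lemma sphere_mean_curvature_eq0 u : U u -> sphere_mean_curvature r2 F u = 0.
Proof.
move=> Uu; have r20 := critical_radius_gt0 n0 lambda0.
have NF : normal_part F u (F u) = F u.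
  by rewrite /normal_part tangent_part_sphere ?subr0.
have NB v c : normal_part F u (v - c *: F u) = normal_part F u v - c *: F u.
  rewrite -[X in _ = _ - _ *: X]NF /normal_part.
  have -> : tangent_part F u (v - c *: F u) =
      tangent_part F u v - c *: tangent_part F u (F u).
    rewrite /tangent_part scaler_sumr -sumrB; apply: eq_bigr => i _.
    rewrite scaler_sumr -sumrB; apply: eq_bigr => j _.
    by rewrite dotBl dotZl scalerA -scalerBl; congr (_ *: _); ring.
  by rewrite scalerBr !opprB addrACA [RHS]addrACA; congr (_ + _); rewrite addrC.
have -> : sphere_mean_curvature r2 F u =
    mean_curvature F u - (dot (laplace_coord F u) (F u) / r2 ^+ 2) *: F u.
  rewrite dot_laplace_coord mulr_suml scaler_suml -sumrB; apply: eq_bigr => i _.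
  rewrite mulr_suml scaler_suml -sumrB; apply: eq_bigr => j _.
  by rewrite /sphere_second_ff /sphere_tangent_part NB scalerBr scalerA mulrA.
have -> : mean_curvature F u = (lambda / r2) *: F u - F u.
  by rewrite -weighted_mean_curvature_sphere// /weighted_mean_curvature NF addrK.
rewrite dot_laplace_coord_sphere// -[X in _ - X - _]scale1r -!scalerBl.
rewrite [X in X *: _](_ : _ = 0) ?scale0r//.
have := critical_radius_eq n lambda; have r2n0 : r2 != 0 by rewrite gt_eqF.
move: (n%:R : R) => k kE.
have -> : k = r2 ^+ 2 - lambda * r2 by rewrite kE; ring.
field; exact: r2n0.
Qed.

End LambdaChart.

(** * Global argument *)

Section GlobalImmersion.
Context {R : realType} {n m : nat}.
Variables (M : smooth_manifold R n) (X : M -> 'rV[R]_m).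
Hypothesis X_immersion : immersion X.

Lemma chart_dom_nbhs (c : chart R n M) x :
  chart_dom c x -> \forall y \near x, chart_dom c y.
Proof. by move=> cx; apply: open_nbhs_nbhs; split=> //; exact: chart_dom_open. Qed.

Lemma near_chart (c : chart R n M) x (P : 'rV[R]_n -> Prop) : chart_dom c x ->
  (\forall v \near chart_map c x, P v) -> \forall y \near x, P (chart_map c y).
Proof. by move=> cx Pv; exact: (@chart_map_cont _ _ _ c x cx _ Pv). Qed.

Lemma near_chart_inv (c : chart R n M) x (P : M -> Prop) : chart_dom c x ->
  (\forall y \near x, P y) -> \forall v \near chart_map c x, P (chart_inv c v).
Proof.
move=> cx Px; apply: (@chart_inv_cont _ _ _ c _ (chart_map_img cx)).
by rewrite chart_mapK.
Qed.

(** The empty list of derivatives in [smooth_on] gives continuity in each chart. *)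
Lemma continuous_immersion : continuous X.
Proof.
move=> x; have [c ac cx] := atlas_cover x; have [sX _] := X_immersion ac.
have [cX _] := sX [::] _ (chart_map_img cx).
rewrite /continuous_at.
have E : \forall y \near x, X (chart_inv c (chart_map c y)) = X y.
  by apply: filterS (chart_dom_nbhs cx) => y cy; rewrite chart_mapK.
apply: (cvg_trans (near_eq_cvg E)).
have -> : X x = X (chart_inv c (chart_map c x)) by rewrite chart_mapK.
exact: (cvg_comp _ _ (@chart_map_cont _ _ _ c x cx) cX).
Qed.

Section LambdaImmersion.
Variable lambda : R.
Hypotheses (n0 : (0 < n)%N) (lambda0 : 0 <= lambda)
  (X_proper : proper_map X) (X_lambda : lambda_submanifold X lambda)
  (X_out : range X `<=` eball_compl (critical_radius n lambda)).
Local Notation r2 := (critical_radius n lambda).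

Lemma continuous_norm2_immersion : continuous (fun x => dot (X x) (X x)).
Proof.
move=> x; exact: (continuous_at_dot (F := X) (G := X)
  (@continuous_immersion x) (@continuous_immersion x)).
Qed.

Lemma compact_norm2_sublevel k : compact [set x : M | dot (X x) (X x) <= k].
Proof. exact: X_proper (@compact_dot_ball _ _ k). Qed.

Lemma closed_critical_set : closed [set x : M | dot (X x) (X x) = r2 ^+ 2].
Proof.
apply: (@closed_comp _ _ (fun x : M => dot (X x) (X x)) [set t | t = r2 ^+ 2]).
  by move=> x _; exact: continuous_norm2_immersion.
exact: closed_eq.
Qed.

Lemma open_critical_set : open [set x : M | dot (X x) (X x) = r2 ^+ 2].
Proof.
rewrite openE => x /= xr2; have [c ac cx] := atlas_cover x.
have [sX jX] := X_immersion ac; have r20 := critical_radius_gt0 n0 lambda0.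
have out v : chart_img c v -> r2 <= enorm ((X \o chart_inv c) v).
  by move=> _; apply: X_out; exists (chart_inv c v).
have /= near_r2 := enorm_critical_open n0 lambda0 (@chart_img_open _ _ _ c) sX jX
  (X_lambda ac) (chart_map_img cx) out.
have : \forall y \near x, dot (X (chart_inv c (chart_map c y)))
    (X (chart_inv c (chart_map c y))) = r2 ^+ 2.
  apply: (near_chart
    (P := fun v => dot (X (chart_inv c v)) (X (chart_inv c v)) = r2 ^+ 2) cx).
  apply: near_r2; rewrite chart_mapK//.
  by apply/eqP; rewrite enorm_eq_sqr// xr2.
by apply: filterS2 (chart_dom_nbhs cx) => y cy; rewrite chart_mapK.
Qed.

Lemma local_min_in_critical_set x :
  (\forall y \near x, dot (X x) (X x) <= dot (X y) (X y)) -> dot (X x) (X x) = r2 ^+ 2.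
Proof.
move=> xmin; have [c ac cx] := atlas_cover x.
have [sX jX] := X_immersion ac; have r20 := critical_radius_gt0 n0 lambda0.
have /= := local_min_enorm_le n0 lambda0 (@chart_img_open _ _ _ c) sX jX
  (X_lambda ac) (chart_map_img cx).
rewrite chart_mapK// => /(_ (near_chart_inv cx xmin)) le_r2.
apply/eqP; rewrite -enorm_eq_sqr// eq_le le_r2.
by apply: X_out; exists x.
Qed.

(* The complement of the critical set is clopen, so the minimum of |X| over
   its compact sublevels is a local minimum on all of M; this replaces the
   decomposition of M into connected components. *)
Lemma norm2_critical x : dot (X x) (X x) = r2 ^+ 2.
Proof.
apply: contrapT => xT; pose T := ~` [set x : M | dot (X x) (X x) = r2 ^+ 2].
have oT : open T by apply: closed_openC; exact: closed_critical_set.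
have cT : closed T by apply: open_closedC; exact: open_critical_set.
pose A := T `&` [set y | dot (X y) (X y) <= dot (X x) (X x)].
have cA : compact A.
  apply: (subclosed_compact _ (@compact_norm2_sublevel (dot (X x) (X x))));
    last by move=> y [].
  apply: closedI => //.
  apply: (@closed_comp _ _ (fun y : M => dot (X y) (X y)) [set t | t <= dot (X x) (X x)]).
    by move=> y _; exact: continuous_norm2_immersion.
  exact: closed_le.
have A0 : A !=set0 by exists x; split; [exact: xT|exact: lexx].
have cf : {within A, continuous (fun y : M => dot (X y) (X y))}.
  by apply: continuous_subspaceT; exact: continuous_norm2_immersion.
have [y] := compact_EVT_min A0 cA cf; rewrite inE => -[Ty yx] ymin.
apply: (Ty); apply: local_min_in_critical_set.
have : \forall z \near y, T z by exact: open_nbhs_nbhs.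
apply: filterS => z Tz; have [zx|/ltW xz] := leP (dot (X z) (X z)) (dot (X x) (X x)).
  by apply: ymin; rewrite inE.
exact: le_trans xz.
Qed.

Lemma compact_lambda_immersion : compact [set: M].
Proof.
rewrite (_ : [set: M] = [set x | dot (X x) (X x) <= r2 ^+ 2]).
  exact: compact_norm2_sublevel.
by apply/seteqP; split=> x //= _; rewrite norm2_critical.
Qed.

Lemma range_sub_esphere : range X `<=` esphere r2.
Proof.
move=> _ [x _ <-]; apply/eqP; rewrite enorm_eq_sqr ?critical_radius_gt0//.
by rewrite norm2_critical.
Qed.

Lemma lambda_immersion_minimal : minimal_in_sphere X r2.
Proof.
split=> [|c ac u cu]; first exact: range_sub_esphere.
have [sX jX] := X_immersion ac.
by apply: (sphere_mean_curvature_eq0 n0 lambda0 (@chart_img_open _ _ _ c) sX jX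
  (X_lambda ac)) => // v _; exact: norm2_critical.
Qed.

End LambdaImmersion.

End GlobalImmersion.

(** * Surjectivity onto the sphere in codimension one *)

Section Codimension1.
Context {R : realType} {n : nat}.
Implicit Types (q : 'rV[R]_(n + 1)).

(** The normal space is the kernel of the transpose of [J], of dimension (n + 1) - n = 1, hence
    spanned by [x]. *)
Lemma row_free_normal_line (J : 'M[R]_(n, n + 1)) (x q : 'rV[R]_(n + 1)) :
  row_free J -> x != 0 -> x *m J^T = 0 -> q *m J^T = 0 -> exists c, q = c *: x.
Proof.
move=> Jfree x0 /sub_kermxP xk /sub_kermxP qk; apply/sub_rVP.
apply: (submx_trans qk); rewrite -(geq_leqif (mxrank_leqif_sup xk)).
by rewrite mxrank_ker mxrank_tr (eqP Jfree) addKn rank_rV x0.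
Qed.

Variables (M : smooth_manifold R n) (X : M -> 'rV[R]_(n + 1)) (r : R).
Hypotheses (n0 : (0 < n)%N) (r0 : 0 < r) (M_nonempty : [set: M] !=set0)
  (X_immersion : immersion X) (cM : compact [set: M])
  (X_sphere : forall x, dot (X x) (X x) = r ^+ 2).
Local Notation e i := (delta_mx 0 i : 'rV[R]_n).

Lemma C2_on_dot_cst U (F : 'rV[R]_n -> 'rV[R]_(n + 1)) q : smooth_on U F ->
  C2_on U (fun v => dot (F v) q) (fun i v => dot (partial i F v) q)
    (fun i j v => dot (partial i (partial j F) v) q).
Proof.
move=> sF u Uu; have [cF dF] := smooth_partial0 sF Uu.
have cq : {for u, continuous (fun _ : 'rV[R]_n => q)} by exact: cst_continuous.
have dq i : is_derive u (e i) (fun _ : 'rV[R]_n => q) 0 := is_derive_cst q u (e i).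
have dot0 (x : 'rV[R]_(n + 1)) : dot x 0 = 0 by rewrite -(scale0r 0) dotZr mul0r.
split=> [|i|i j].
- exact: (continuous_at_dot (F := F) cF cq).
- split; last first.
    exact: (continuous_at_dot (F := partial i F) (smooth_partial1 sF i Uu).1 cq).
  apply: (is_derive_eq (is_derive_dot (dF i) (dq i))).
  by rewrite dot0 addr0.
- split; last first.
    exact: (continuous_at_dot (F := partial i (partial j F))
      (@smooth_partial2 _ _ _ _ _ sF u i j Uu) cq).
  apply: (is_derive_eq (is_derive_dot ((smooth_partial1 sF j Uu).2 i) (dq i))).
  by rewrite dot0 addr0.
Qed.

Lemma range_hypersurface_sphere : range X = esphere r.
Proof.
have sphereE x : esphere r x = (dot x x = r ^+ 2).
  apply/propext; rewrite /esphere /=.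
  by split=> /eqP H; apply/eqP; move: H; rewrite enorm_eq_sqr.
apply/seteqP; split=> [_ [x _ <-]|q]; rewrite sphereE ?X_sphere// => qr.
apply: contrapT => qX.
have cXq : continuous (fun x : M => dot (X x) q).
  move=> x; apply: (continuous_at_dot (F := X) (G := fun=> q)); last exact: cst_continuous.
  exact: continuous_immersion.
have [x1 _ x1max] := compact_EVT_max M_nonempty cM (continuous_subspaceT cXq).
have {}x1max x : dot (X x) q <= dot (X x1) q by apply: x1max; rewrite inE.
have [c ac cx] := atlas_cover x1; have [sF jF] := X_immersion ac.
set F := X \o chart_inv c in sF jF; set u := chart_map c x1.
have Uu : chart_img c u := chart_map_img cx.
have Fu : F u = X x1 by rewrite /F /= chart_mapK.
have J_free := row_free_tangent_frame n0 jF Uu.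
have critical q' : (forall v, dot (F u) q' <= dot (F v) q') ->
    q' *m (tangent_frame F u)^T = 0.
  move=> q'min; have q'near : \forall v \near u, dot (F u) q' <= dot (F v) q'.
    by near=> v; exact: q'min.
  have [q'0 _] := second_derivative_test (@chart_img_open _ _ _ c) Uu
    (C2_on_dot_cst q' sF) q'near.
  apply/rowP => i; rewrite !mxE -[RHS](q'0 i) dotC /dot.
  by apply: eq_bigr => k _; rewrite !mxE.
have x10 : X x1 != 0 by rewrite -dot_gt0 X_sphere exprn_gt0.
(* A maximum of the height along [q] is a minimum of the height along [- q]. *)
have qJ : q *m (tangent_frame F u)^T = 0.
  apply/eqP; rewrite -oppr_eq0 -mulNmx; apply/eqP; apply: critical => v.
  by rewrite !(dotC _ (- q)) !dotNl lerN2 !(dotC q) Fu x1max.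
have xJ : X x1 *m (tangent_frame F u)^T = 0.
  have F_sphere v : dot (F v) (F v) = r ^+ 2 by exact: X_sphere.
  apply/rowP => i; rewrite !mxE.
  have Fmin : \forall v \near u, half_norm2 F u <= half_norm2 F v.
    by near=> v; rewrite /half_norm2 !F_sphere.
  have [/(_ i) Fi0 _] := second_derivative_test (@chart_img_open _ _ _ c) Uu
    (C2_on_half_norm2 sF) Fmin.
  rewrite -[RHS]Fi0 /half_norm2_1 dotC Fu /dot.
  by apply: eq_bigr => k _; rewrite !mxE.
have [k qk] := row_free_normal_line J_free x10 xJ qJ.
(* Both vectors have length [r], so k^2 = 1; k = 1 would put [q] in the range. *)
have kN1 : k = -1.
  have : k ^+ 2 = 1.
    apply: (mulIf (expf_neq0 2 (lt0r_neq0 r0))).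
    by rewrite mul1r -[RHS]qr qk dotZl dotZr X_sphere mulrA.
  move=> /eqP; rewrite sqrf_eq1 => /predU1P[k1|/eqP//].
  by exfalso; apply: qX; exists x1 => //; rewrite qk k1 scale1r.
(* As q = - X x1, maximality reads <X x, X x1> >= r^2, which forces |X x - X x1|^2 <= 0. *)
have Xcst x : X x = X x1.
  apply/eqP; rewrite -subr_eq0 -dot_eq0 eq_le dot_ge0 andbT.
  have := x1max x; rewrite qk kN1 !dotZr X_sphere.
  rewrite dotBl !dotBr (dotC (X x1) (X x)) !X_sphere.
  move: (dot _ _) (r ^+ 2) => d s H; lra.
have F0 : tangent_frame F u = 0.
  apply/row_matrixP => i; rewrite rowK row0 /partial.
  rewrite -(derive_cst (X x1) u (e i)); apply: near_eq_derive.
  by near=> v; rewrite /F /= Xcst.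
by move: J_free; rewrite F0 /row_free mxrank0 => /eqP n_eq0; move: n0; rewrite -n_eq0.
Unshelve. all: by end_near. Qed.

End Codimension1.

Unset Implicit Arguments.

Theorem theorem9 (R : realType) (n p : nat) (hn : (1 <= n)%N) (hp : (1 <= p)%N)
    (lambda : R) (hlambda : 0 <= lambda)
    (M : smooth_manifold R n) (M_nonempty : [set: M] !=set0)
    (X : M -> 'rV[R]_(n + p)) (X_immersion : immersion X)
    (X_complete : complete_immersion X) (X_proper : proper_map X)
    (X_lambda : lambda_submanifold X lambda) :
  let r2 := (lambda + Num.sqrt (lambda ^+ 2 + 4 * n%:R)) / 2 in
  range X `<=` eball_compl r2 ->
  [/\ compact [set: M],
      range X `<=` esphere r2,
      minimal_in_sphere X r2 &
      p = 1%N -> range X = esphere r2].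
Proof.
move=> r2 X_out; rewrite -[r2]/(critical_radius n lambda) in X_out *.
have c0 := critical_radius_gt0 hn hlambda.
split.
- exact: (compact_lambda_immersion X_immersion hn hlambda X_proper X_lambda X_out).
- exact: (range_sub_esphere X_immersion hn hlambda X_proper X_lambda X_out).
- exact: (lambda_immersion_minimal X_immersion hn hlambda X_proper X_lambda X_out).
- move=> p1; subst p; apply: range_hypersurface_sphere => //.
    exact: (compact_lambda_immersion X_immersion hn hlambda X_proper X_lambda X_out).
  exact: (norm2_critical X_immersion hn hlambda X_proper X_lambda X_out).
Qed.
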